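(* For each $n \ge 1$ let $p_n(z) = \sum_{k=0}^{n} a_k z^k$, where the $a_k$ are i.i.d. standard complex Gaussian random variables $N_{\mathbb{C}}(0,1)$, and let $\Lambda_n = \{z \in \mathbb{C} : |p_n(z)| = 1\}$. Let $(L_n)$ be any sequence of real numbers with $L_n \to \infty$ as $n\to\infty$. Then $$\lim_{n\to\infty} \mathbb{P}\{ |\Lambda_n| \ge L_n \} = 0 .$$
   Context: A random variable has the standard complex Gaussian distribution $N_{\mathbb{C}}(0,1)$ if it has density $\frac{1}{\pi} e^{-|z|^2}$ on $\mathbb{C}$ with respect to Lebesgue measure. $|\Lambda_n|$ denotes the arc length (one-dimensional Hausdorff measure) of the curve $\Lambda_n$. *)

(* Defs.v *)
From mathcomp Require Import all_boot all_order all_algebra.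
From mathcomp Require Import complex.
From mathcomp Require Import all_classical all_reals all_analysis.

Set Implicit Arguments.
Unset Strict Implicit.
Unset Printing Implicit Defensive.

Import Order.TTheory GRing.Theory Num.Theory.
Import numFieldNormedType.Exports.

Local Open Scope classical_set_scope.
Local Open Scope ring_scope.
Local Open Scope ereal_scope.

(* The Borel sets of C are the preimages of the measurable sets of R * R under
   [coords], and planar Lebesgue measure is the product Lebesgue measure on
   R * R. *)
Definition coords (R : realType) (z : R[i]) : R * R := (complex.Re z, complex.Im z).

Definition cgauss_pdf (R : realType) (z : R[i]) : R :=
  (pi^-1 * expR (- Normc.normc z ^+ 2))%R.

Definition std_cgauss (R : realType) (d : measure_display)
    (T : measurableType d) (P : probability T R) (Z : T -> R[i]) : Prop :=
  measurable_fun [set: T] (@coords R \o Z) /\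
  forall B : set (R * R), measurable B ->
    P ((@coords R \o Z) @^-1` B) =
    \int[(@lebesgue_measure R \x @lebesgue_measure R)]_(u in B)
      (cgauss_pdf (Complex u.1 u.2))%:E.

Definition mutually_independent (R : realType) (d : measure_display)
    (T : measurableType d) (P : probability T R) (I : finType)
    (Z : I -> T -> R[i]) : Prop :=
  forall (J : {set I}) (B : I -> set (R * R)),
    (forall j, measurable (B j)) ->
    P (\bigcap_(j in [set` J]) ((@coords R \o Z j) @^-1` B j)) =
    \prod_(j in J) P ((@coords R \o Z j) @^-1` B j).

Definition iid_std_cgauss (R : realType) (d : measure_display)
    (T : measurableType d) (P : probability T R) (I : finType)
    (Z : I -> T -> R[i]) : Prop :=
  (forall i, std_cgauss P (Z i)) /\ mutually_independent P Z.

Definition random_poly (R : realType) (T : Type) (n : nat)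
    (a : 'I_n.+1 -> T -> R[i]) (w : T) : {poly R[i]} :=
  (\sum_(k < n.+1) a k w *: 'X^k)%R.

Definition lemniscate (R : realType) (p : {poly R[i]}) : set R[i] :=
  [set z | `|p.[z]|%R = 1%R].

(* The maximum with 0 gives the empty set diameter 0 rather than -oo. *)
Definition cdiam (R : realType) (U : set R[i]) : \bar R :=
  maxe 0 (ereal_sup [set (Normc.normc (z - w)%R)%:E | z in U & w in U]).

Definition hausdorff1_pre (R : realType) (delta : R) (A : set R[i]) : \bar R :=
  ereal_inf [set \sum_(0 <= i <oo) cdiam (U i) | U in
    [set U : nat -> set R[i] |
      (forall i, cdiam (U i) <= delta%:E) /\ A `<=` \bigcup_i U i]].

(* For s = 1 the normalising constant of s-dimensional Hausdorff measure is 1,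
   so this is arc length on rectifiable curves. *)
Definition hausdorff1 (R : realType) (A : set R[i]) : \bar R :=
  ereal_sup [set hausdorff1_pre delta A | delta in [set delta : R | (0 < delta)%R]].

(* Main.v *)
Require Import Defs.
From HB Require Import structures.
From mathcomp Require Import all_boot all_order all_algebra.
From mathcomp Require Import zify ring lra.
From mathcomp Require Import complex.
From mathcomp Require Import all_classical all_reals all_analysis.
From mathcomp Require Import measurable_realfun lebesgue_integral normal_distribution.
Set Implicit Arguments.
Unset Strict Implicit.
Unset Printing Implicit Defensive.
Import Order.TTheory GRing.Theory Num.Theory.
Import numFieldNormedType.Exports.
Local Open Scope classical_set_scope.
Local Open Scope ring_scope.

(* The expected length of the lemniscate is bounded uniformly in the degree, and
   Markov's inequality concludes.

   Upper bound for the length.  Cut the plane into polar cells of mesh about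
   1/m.  Pathwise, for m large, every cell of center z and width eta that meets
   the lemniscate satisfies |p(z)| <= 2 and ||p(z)| - 1| <= eta (|p'(z)| + 1), so
   the length is at most the liminf over m of the total diameter of the cells
   satisfying this condition.  By Fatou's lemma it remains to bound the expected
   total diameter.

   One point.  Let K and V be the variances of p(z) and p'(z).  Regressing p'(z)
   on the Gaussian variable p(z), whose density is at most 1 / (pi K), one finds
   that the condition has probability O(eta (1 + sqrt V) / K).  The regression is
   obtained by adding the terms of the polynomial one at a time; each step only
   uses Tonelli's theorem and translations, through completing the square.

   Summation.  With r = |z|, (1 + sqrt V) / K is O((1 - r)^(-1/2)) for r < 1 and
   O(sqrt n r^(-n/2)) for r >= 1, so its integral over the plane is bounded
   uniformly in n.

   Measurability of the event.  The cost of covering a compact lemniscate can be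
   computed with finite families of rational boxes, and a lemniscate meets a box
   iff |p| gets arbitrarily close to 1 at rational points of it. *)

(** * Gaussian regression on the plane *)

(** A cell of width eta contributes its diameter times a probability of order eta, hence an area:
    the expected grid sums are Riemann sums of [(1 + sqrt V) / K]. The shape of the cell condition
    is forced. The summand 1 in [|p'(z)| + 1] absorbs the quadratic Taylor remainder, whose constant
    depends on the polynomial; the condition therefore holds only for [m] beyond a random threshold,
    which is why a liminf and Fatou's lemma appear. The cut-off [|p(z)| <= 2] keeps the area of the
    annulus a multiple of its width for every width, and it bounds [|p'(z)|] by [2 |c|] plus the
    residual of the regression, [c] being the regression coefficient. The lemniscate has no
    deterministic bound, so the grid must exhaust the plane: it reaches radius [m] and uses the same
    angles at every radius. Its cells thus widen like [1 + |z|], and the decay of [(1 + sqrt V) / K]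
    outside the unit disc pays for that. *)

Lemma ge0_integral_density d (T : measurableType d) (R : realType)
    (nu : {finite_measure set T -> \bar R})
    (mu : {sigma_finite_measure set T -> \bar R}) (g : T -> R) :
  measurable_fun [set: T] g -> (forall x, 0 <= g x) ->
  (forall A, measurable A -> nu A = \int[mu]_(x in A) (g x)%:E)%E ->
  forall f : T -> \bar R, measurable_fun [set: T] f -> (forall x, 0 <= f x)%E ->
  (\int[nu]_x f x = \int[mu]_x (f x * (g x)%:E))%E.
Proof.
move=> mg g0 nug f mf f0.
have numu : nu `<< mu.
  apply/null_content_dominatesP => A mA muA0; rewrite nug//.
  apply: null_set_integral => //.
  exact/measurable_EFinP/measurable_funTS.
have ig : mu.-integrable [set: T] (EFin \o g).
  apply/integrableP; split; first exact/measurable_EFinP.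
  under eq_integral do rewrite /= ger0_norm//.
  by rewrite -nug// fin_num_fun_lty//; exact: fin_num_measure.
(* The change of variables is available for the Radon-Nikodym derivative, which agrees with [g]
   almost everywhere. *)
rewrite -(Radon_Nikodym_SigmaFinite.change_of_variables numu f0 measurableT mf).
have mh : measurable_fun [set: T] (Radon_Nikodym_SigmaFinite.f nu mu).
  exact: (measurable_int _ (Radon_Nikodym_SigmaFinite.f_integrable numu)).
apply: ae_eq_integral => //.
- exact: emeasurable_funM.
- by apply: emeasurable_funM => //; exact/measurable_EFinP.
- apply: ae_eqe_mul2l; apply: integral_ae_eq => //.
  + exact: Radon_Nikodym_SigmaFinite.f_integrable.
  + exact/measurable_EFinP.
  + by move=> A _ mA; rewrite -Radon_Nikodym_SigmaFinite.f_integral// nug.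
Qed.

Lemma measurable_setb d (T : measurableType d) (f : T -> bool) :
  measurable_fun [set: T] f -> measurable [set x | f x].
Proof.
move=> mf; have -> : [set x | f x] = [set: T] `&` f @^-1` [set true].
  by rewrite setTI; apply/seteqP; split => x.
exact: mf.
Qed.

(* A constant of its own: on the bare product the only canonical instances found
   beyond [Measure] are those of products of probabilities, so that Tonelli's
   theorem, which wants a sigma-finite measure, would not apply. *)
Definition lam2 {R : realType} :
    set (measurableTypeR R * measurableTypeR R) -> \bar R :=
  (@lebesgue_measure R \x @lebesgue_measure R)%E.

HB.instance Definition _ (R : realType) := Measure.on (@lam2 R).

Lemma sigma_finite_lam2 (R : realType) : sigma_finite setT (@lam2 R).
Proof.
have /sigma_finiteP[F [TF ndF Foo]] := sigma_finiteT (@lebesgue_measure R).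
exists (fun n => F n `*` F n).
  rewrite -setXTT TF predeqE => -[x y]; split.
    move=> [/= [n _ Fnx] [k _ Gky]]; exists (maxn n k) => //; split.
    - by move: x Fnx; exact/subsetPset/ndF/leq_maxl.
    - by move: y Gky; exact/subsetPset/ndF/leq_maxr.
  by move=> [n _ []/= ? ?]; split; exists n.
move=> k; have [? ?] := Foo k; split; first exact: measurableX.
by rewrite /lam2 product_measure1E// lte_mul_pinfty// ge0_fin_numE.
Qed.

HB.instance Definition _ (R : realType) :=
  Measure_isSigmaFinite.Build _ _ _ (@lam2 R) (@sigma_finite_lam2 R).

(** * Planar Lebesgue measure and complex Gaussian densities *)

Section plane_measure.
Variable R : realType.
Implicit Types (u v w y : R * R) (s t k : R).
Local Notation leb := (@lebesgue_measure R).
Local Notation lam2 := (@lam2 R).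

Lemma lebesgue_measure_addr t (A : set R) : measurable A ->
  pushforward leb (fun x : R => (x + t : measurableTypeR R)) A = leb A.
Proof.
move=> mA.
have mphi : measurable_fun [set: measurableTypeR R] (fun x : R => (x + t : measurableTypeR R)).
  exact: measurable_funD.
apply/esym.
pose m0 : {measure set (measurableTypeR R) -> \bar R} :=
  pushforward leb (fun x : R => (x + t : measurableTypeR R)).
set m := m0 mphi.
suff H : forall X, ocitv X -> leb X = m X by exact: (@lebesgue_measure_unique _ m H).
move=> _ [[a b]] _ <-.
rewrite /m /m0 /= /pushforward /=.
have -> : (fun x : R => x + t) @^-1` `]a, b] = `](a - t), (b - t)]%classic.
  by apply/seteqP; split => x /=; rewrite !in_itv/= ltrBlDr lerBrDr.
rewrite !lebesgue_measure_itv/= !lte_fin ltrD2r.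
rewrite -!EFinB; have -> : b - t - (a - t) = b - a by ring.
by [].
Qed.

Lemma lebesgue_measure_oppr (A : set R) : measurable A ->
  pushforward leb (fun x : R => (- x : measurableTypeR R)) A = leb A.
Proof. exact: lebesgue_measureN. Qed.

Lemma lebesgue_measure_scale s (A : set R) : 0 < s -> measurable A ->
  (s%:E * leb ((fun x : R => (s * x)%R : measurableTypeR R) @^-1` A) = leb A)%E.
Proof.
move=> s0 mA.
have mphi : measurable_fun [set: measurableTypeR R] (fun x : R => (s * x : measurableTypeR R)).
  exact: measurable_funM.
apply/esym.
pose m0 : {measure set (measurableTypeR R) -> \bar R} :=
  mscale (NngNum (ltW s0)) (pushforward leb (fun x : R => (s * x : measurableTypeR R))).
set m := m0 mphi.
suff H : forall X, ocitv X -> leb X = m X by exact: (@lebesgue_measure_unique _ m H).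
move=> _ [[a b]] _ <-.
rewrite /m /m0 /= /mscale /= /pushforward /=.
have -> : (fun x : R => s * x) @^-1` `]a, b] = `](a / s), (b / s)]%classic.
  by apply/seteqP; split => x /=; rewrite !in_itv/= ltr_pdivrMr// ler_pdivlMr// ![x * s]mulrC.
rewrite !lebesgue_measure_itv/= !lte_fin ltr_pM2r ?invr_gt0//.
case: ifP => _; last by rewrite mule0.
by rewrite -EFinM -mulrBl mulrCA divff ?mulr1// gt_eqF.
Qed.

(** A product measure is determined by its values on rectangles. Translations and the reflection
    through the origin are the instances used. *)
Lemma lam2_prod_map (f g : R -> R) :
  measurable_fun [set: R] f -> measurable_fun [set: R] g ->
  (forall A, measurable A -> leb (f @^-1` A) = leb A) ->
  (forall A, measurable A -> leb (g @^-1` A) = leb A) ->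
  forall h : R * R -> \bar R, measurable_fun [set: R * R] h -> (forall x, 0 <= h x)%E ->
  (\int[lam2]_x h (f x.1, g x.2) = \int[lam2]_x h x)%E.
Proof.
move=> mf mg lf lg h mh h0.
have mphi : measurable_fun [set: R * R] (fun x : R * R => ((f x.1, g x.2) : (measurableTypeR R * measurableTypeR R)%type)).
  by apply: measurable_fun_pair => /=; apply: measurableT_comp.
pose m0 : {measure set (measurableTypeR R * measurableTypeR R) -> \bar R} :=
  pushforward lam2 (fun x : R * R => ((f x.1, g x.2) : (measurableTypeR R * measurableTypeR R)%type)).
set m := m0 mphi.
have H : forall X, measurable X -> lam2 X = m X.
  apply: (@product_measure_unique _ _ _ _ R leb leb m) => A B mA mB.
  rewrite /m /m0 /= /pushforward /=.
  have -> : (fun x => (f x.1, g x.2)) @^-1` (A `*` B) = (f @^-1` A) `*` (g @^-1` B).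
    by apply/seteqP; split => x /=.
  have mfA : measurable (f @^-1` A) by rewrite -[_ @^-1` _]setTI; exact: mf.
  have mgB : measurable (g @^-1` B) by rewrite -[_ @^-1` _]setTI; exact: mg.
  by rewrite /lam2 product_measure1E//; congr (_ * _)%E; [exact: lf|exact: lg].
have -> : (\int[lam2]_x h x = \int[m]_x h x)%E.
  by apply: eq_measure_integral => A mA _; exact: H.
rewrite /m /m0 ge0_integral_pushforward//.
Qed.

Lemma lam2_translate t s (h : R * R -> \bar R) :
  measurable_fun [set: R * R] h -> (forall x, 0 <= h x)%E ->
  (\int[lam2]_x h (x.1 + t, x.2 + s)%R = \int[lam2]_x h x)%E.
Proof.
apply: (@lam2_prod_map (fun x => x + t)%R (fun x => x + s)%R).
- exact: measurable_funD.
- exact: measurable_funD.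
- exact: lebesgue_measure_addr.
- exact: lebesgue_measure_addr.
Qed.

Lemma lam2_opp (h : R * R -> \bar R) :
  measurable_fun [set: R * R] h -> (forall x, 0 <= h x)%E ->
  (\int[lam2]_x h (- x.1, - x.2)%R = \int[lam2]_x h x)%E.
Proof.
apply: (@lam2_prod_map (fun x => - x)%R (fun x => - x)%R).
- exact: measurableT_comp.
- exact: measurableT_comp.
- exact: lebesgue_measure_oppr.
- exact: lebesgue_measure_oppr.
Qed.

Lemma lam2_scale s (A : set (R * R)) : 0 < s -> measurable A ->
  ((s ^+ 2)%:E * lam2 ((fun x => (s * x.1, s * x.2)%R) @^-1` A) = lam2 A)%E.
Proof.
move=> s0 mA.
have mphi : measurable_fun [set: R * R] (fun x : R * R => ((s * x.1, s * x.2) : (measurableTypeR R * measurableTypeR R)%type)).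
  by apply: measurable_fun_pair => /=; apply: measurable_funM.
pose m0 : {measure set (measurableTypeR R * measurableTypeR R) -> \bar R} :=
  mscale (NngNum (sqr_ge0 s)) (pushforward lam2 (fun x : R * R => ((s * x.1, s * x.2) : (measurableTypeR R * measurableTypeR R)%type))).
set m := m0 mphi.
apply/esym; apply: (@product_measure_unique _ _ _ _ R leb leb m) => // {mA} {}A B mA mB.
rewrite /m /m0 /= /mscale /= /pushforward /=.
have -> : (fun x => (s * x.1, s * x.2)) @^-1` (A `*` B) =
    ((fun x => s * x) @^-1` A) `*` ((fun x => s * x) @^-1` B).
  by apply/seteqP; split => x /=.
have ms : measurable_fun [set: R] (fun x : R => s * x) by exact: measurable_funM.
rewrite /lam2 product_measure1E//; [|by rewrite -[_ @^-1` _]setTI; exact: ms..].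
rewrite expr2 EFinM muleACA.
by congr (_ * _)%E; exact: lebesgue_measure_scale.
Qed.

(** Squared modulus, sum and product of complex numbers, written on pairs because the Borel
    structure is that of [R * R]. *)
Definition nrm2 u : R := u.1 ^+ 2 + u.2 ^+ 2.
Definition cadd u v : R * R := (u.1 + v.1, u.2 + v.2).
Definition cmul u v : R * R := (u.1 * v.1 - u.2 * v.2, u.1 * v.2 + u.2 * v.1).

Lemma nrm2_ge0 u : 0 <= nrm2 u.
Proof. by rewrite addr_ge0 ?sqr_ge0. Qed.

Lemma measurable_nrm2 : measurable_fun [set: R * R] nrm2.
Proof. by apply: measurable_funD; apply: measurable_funX. Qed.

Section measurable_ops.
Context d (T : measurableType d).
Implicit Types f g : T -> R * R.

Lemma measurable_fun_fst f : measurable_fun [set: T] f ->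
  measurable_fun [set: T] (fun x => (f x).1).
Proof. by move=> mf; exact: measurableT_comp. Qed.

Lemma measurable_fun_snd f : measurable_fun [set: T] f ->
  measurable_fun [set: T] (fun x => (f x).2).
Proof. by move=> mf; exact: measurableT_comp. Qed.

Lemma measurable_cadd f g : measurable_fun [set: T] f -> measurable_fun [set: T] g ->
  measurable_fun [set: T] (fun x => cadd (f x) (g x)).
Proof.
by move=> mf mg; apply: measurable_fun_pair; apply: measurable_funD;
  (exact: measurable_fun_fst || exact: measurable_fun_snd).
Qed.

Lemma measurable_cmul f g : measurable_fun [set: T] f -> measurable_fun [set: T] g ->
  measurable_fun [set: T] (fun x => cmul (f x) (g x)).
Proof.
move=> mf mg; apply: measurable_fun_pair; [apply: measurable_funB|apply: measurable_funD];
  by apply: measurable_funM; (exact: measurable_fun_fst || exact: measurable_fun_snd).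
Qed.

End measurable_ops.

Definition disc s : set (R * R) := [set u | nrm2 u < s ^+ 2].

Lemma measurable_disc s : measurable (disc s).
Proof.
by apply: measurable_setb; apply: measurable_fun_ltr => //; exact: measurable_nrm2.
Qed.

Lemma lam2_box s : 0 <= s -> lam2 (`[- s, s] `*` `[- s, s]) = (4 * s ^+ 2)%:E.
Proof.
move=> s0; have H : leb `[- s, s]%classic = (2 * s)%:E.
  rewrite lebesgue_measure_itv/= lte_fin.
  have [ss|ss] := ltP (- s) s; first by rewrite -EFinB; congr EFin; ring.
  by congr EFin; lra.
rewrite /lam2 product_measure1E//.
by transitivity ((2 * s)%:E * (2 * s)%:E)%E; [congr (_ * _)%E|rewrite -EFinM; congr EFin; ring].
Qed.

(** The centred complex Gaussian of variance [k], the variance being the mean of the squared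
    modulus; each coordinate has variance [k / 2]. *)
Definition gpdf k y : R := (pi * k)^-1 * expR (- (nrm2 y / k)).

Lemma gpdf_ge0 k y : 0 <= k -> 0 <= gpdf k y.
Proof. by move=> k0; rewrite mulr_ge0 ?expR_ge0// invr_ge0 mulr_ge0// pi_ge0. Qed.

Lemma measurable_gpdf k : measurable_fun [set: R * R] (gpdf k).
Proof.
apply: measurable_funM => //; apply: measurableT_comp => //.
apply: measurable_funN; apply: measurable_funM => //; exact: measurable_nrm2.
Qed.

Lemma gpdf_normal_pdf k y : 0 < k ->
  gpdf k y = normal_pdf 0 (Num.sqrt (k / 2)) y.1 * normal_pdf 0 (Num.sqrt (k / 2)) y.2.
Proof.
move=> k0; have s0 : Num.sqrt (k / 2) != 0 by rewrite gt_eqF// sqrtr_gt0 divr_gt0.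
rewrite normal_pdfE// /normal_peak /normal_fun !subr0 sqr_sqrtr; last by rewrite divr_ge0// ltW.
have -> : k / 2 * pi *+ 2 = pi * k by rewrite -mulr_natr; field.
rewrite mulrACA -invfM -expr2 sqr_sqrtr; last by rewrite mulr_ge0// ?pi_ge0// ltW.
rewrite -expRD /gpdf /nrm2; congr (_ * expR _).
have -> : k / 2 *+ 2 = k by rewrite -mulr_natr; field.
ring.
Qed.

Lemma integral_gpdf k : 0 < k -> (\int[lam2]_y (gpdf k y)%:E = 1)%E.
Proof.
move=> k0.
have mg : measurable_fun [set: R * R] (fun y => (gpdf k y)%:E).
  by apply/measurable_EFinP; exact: measurable_gpdf.
rewrite (@fubini_tonelli1 _ _ _ _ _ leb leb)//; last first.
  by move=> x; rewrite lee_fin gpdf_ge0// ltW.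
rewrite /fubini_F.
set s := Num.sqrt (k / 2).
transitivity (\int[leb]_x ((normal_pdf 0 s x)%:E * 1))%E; last first.
  by under eq_integral do rewrite mule1; exact: integral_normal_pdf.
apply: eq_integral => x _.
under eq_integral do rewrite gpdf_normal_pdf//= EFinM.
rewrite ge0_integralZl//.
- by rewrite integral_normal_pdf.
- by apply/measurable_EFinP; exact: measurable_normal_pdf.
- by move=> y _; rewrite lee_fin normal_pdf_ge0.
- by rewrite lee_fin normal_pdf_ge0.
Qed.

(** The exact value is [k]. The factor 4 comes from splitting the exponential in two equal halves:
    one absorbs [nrm2 y / (2 * k)], by [x * exp (- x) <= 1], and the other is a Gaussian of variance
    [2 * k]. *)
Lemma integral_nrm2_gpdf k : 0 < k ->
  (\int[lam2]_y (nrm2 y * gpdf k y)%:E <= (4 * k)%:E)%E.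
Proof.
move=> k0.
have mg : measurable_fun [set: R * R] (fun y => (nrm2 y * gpdf k y)%:E).
  by apply/measurable_EFinP; apply: measurable_funM; [exact: measurable_nrm2|exact: measurable_gpdf].
have k20 : 0 < 2 * k by rewrite mulr_gt0.
apply: (@le_trans _ _ (\int[lam2]_y ((4 * k)%:E * (gpdf (2 * k) y)%:E))%E).
  apply: ge0_le_integral => //.
  - by move=> y _; rewrite lee_fin mulr_ge0 ?nrm2_ge0// gpdf_ge0// ltW.
  - by apply/measurable_EFinP; apply: measurable_funM => //; exact: measurable_gpdf.
  - move=> y _; rewrite -EFinM lee_fin /gpdf.
    have : 0 < pi :> R by exact: pi_gt0.
    move: (pi : R) => p p0.
    have -> : nrm2 y / k = nrm2 y / (2 * k) + nrm2 y / (2 * k) by field; rewrite gt_eqF.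
    rewrite opprD expRD.
    set e := expR _; set q := nrm2 y.
    have e0 : 0 < e by exact: expR_gt0.
    have H : q / (2 * k) * e <= 1.
      rewrite /e expRN -/q ler_pdivrMr ?expR_gt0// mul1r.
      by apply: le_trans (expR_ge1Dx _); lra.
    have -> : q * ((p * k)^-1 * (e * e)) = ((2 * p^-1) * e) * (q / (2 * k) * e).
      by field; rewrite !gt_eqF.
    have -> : 4 * k * ((p * (2 * k))^-1 * e) = ((2 * p^-1) * e) * 1.
      by field; rewrite !gt_eqF.
    rewrite ler_wpM2l//; apply: mulr_ge0; last exact: ltW.
    by apply: mulr_ge0 => //; rewrite invr_ge0; exact: ltW.
rewrite ge0_integralZl//.
- by rewrite integral_gpdf// mule1.
- by apply/measurable_EFinP; exact: measurable_gpdf.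
- by move=> y _; rewrite lee_fin gpdf_ge0// ltW.
- by rewrite lee_fin mulr_ge0// ltW.
Qed.

Lemma gpdf_opp k y : gpdf k (- y.1, - y.2) = gpdf k y.
Proof. by rewrite /gpdf /nrm2/= !sqrrN. Qed.

(* Averaging over [h] and [- h] kills the cross term of the square. *)
Lemma integral_affine_nrm2 k alpha beta (w kap : R * R) : 0 < k ->
  0 <= alpha -> 0 <= beta ->
  (\int[lam2]_h ((alpha + beta * nrm2 (cadd w (cmul kap h))) * gpdf k h)%:E <=
   (alpha + beta * nrm2 w + beta * (4 * k * nrm2 kap))%:E)%E.
Proof.
move=> k0 a0 b0.
pose F h := ((alpha + beta * nrm2 (cadd w (cmul kap h))) * gpdf k h)%:E.
pose G h := ((alpha + beta * nrm2 w) * gpdf k h)%:E.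
pose H h := (beta * nrm2 kap * (nrm2 h * gpdf k h))%:E.
have mk : measurable_fun [set: R * R] (cst kap : R * R -> R * R) by exact: measurable_cst.
have mw : measurable_fun [set: R * R] (cst w : R * R -> R * R) by exact: measurable_cst.
have mF : measurable_fun [set: R * R] F.
  apply/measurable_EFinP; apply: measurable_funM; last exact: measurable_gpdf.
  apply: measurable_funD => //; apply: measurable_funM => //.
  apply: (measurableT_comp measurable_nrm2).
  by apply: (measurable_cadd mw); exact: measurable_cmul.
have F0 h : (0 <= F h)%E.
  by rewrite lee_fin mulr_ge0 ?gpdf_ge0 ?(ltW k0)// addr_ge0// mulr_ge0// nrm2_ge0.
have mG : measurable_fun [set: R * R] G.
  by apply/measurable_EFinP; apply: measurable_funM => //; exact: measurable_gpdf.
have G0 h : (0 <= G h)%E.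
  by rewrite lee_fin mulr_ge0 ?gpdf_ge0 ?(ltW k0)// addr_ge0// mulr_ge0// nrm2_ge0.
have mH : measurable_fun [set: R * R] H.
  apply/measurable_EFinP; apply: measurable_funM => //.
  by apply: measurable_funM; [exact: measurable_nrm2|exact: measurable_gpdf].
have H0 h : (0 <= H h)%E.
  by rewrite lee_fin; apply: mulr_ge0; apply: mulr_ge0 => //; rewrite ?nrm2_ge0// gpdf_ge0// ltW.
have mFN : measurable_fun [set: R * R] (fun h => F (- h.1, - h.2)).
  apply: (measurableT_comp mF); apply: measurable_fun_pair; by apply: measurable_funN.
have FG : (\int[lam2]_h F h + \int[lam2]_h F h =
    \int[lam2]_h G h + \int[lam2]_h G h + (\int[lam2]_h H h + \int[lam2]_h H h))%E.
  rewrite -{2}(lam2_opp mF F0) -!ge0_integralD//.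
  - apply: eq_integral => h _; rewrite /F /G /H gpdf_opp -!EFinD; congr EFin.
    by rewrite /nrm2 /cadd /cmul/=; ring.
  - by move=> h _; rewrite adde_ge0.
  - exact: emeasurable_funD.
  - by move=> h _; rewrite adde_ge0.
  - exact: emeasurable_funD.
have iG : (\int[lam2]_h G h = (alpha + beta * nrm2 w)%:E)%E.
  rewrite /G; under eq_integral do rewrite EFinM.
  rewrite ge0_integralZl//.
  - by rewrite integral_gpdf// mule1.
  - by apply/measurable_EFinP; exact: measurable_gpdf.
  - by move=> y _; rewrite lee_fin gpdf_ge0// ltW.
  - by rewrite lee_fin addr_ge0// mulr_ge0// nrm2_ge0.
have iH : (\int[lam2]_h H h <= (beta * (4 * k * nrm2 kap))%:E)%E.
  rewrite /H; under eq_integral do rewrite EFinM.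
  rewrite ge0_integralZl//.
  - have -> : beta * (4 * k * nrm2 kap) = beta * nrm2 kap * (4 * k) by ring.
    rewrite [leRHS]EFinM lee_wpmul2l// ?integral_nrm2_gpdf//.
    by rewrite lee_fin mulr_ge0// nrm2_ge0.
  - apply/measurable_EFinP.
    by apply: measurable_funM; [exact: measurable_nrm2|exact: measurable_gpdf].
  - by move=> y _; rewrite lee_fin mulr_ge0// ?nrm2_ge0// gpdf_ge0// ltW.
  - by rewrite lee_fin mulr_ge0// nrm2_ge0.
have iF0 : (0 <= \int[lam2]_h F h)%E by exact: integral_ge0.
rewrite -/(F _) -[X in (X <= _)%E]/(\int[lam2]_h F h)%E.
move: FG iH; rewrite iG; case: (\int[lam2]_h F h)%E iF0 => [f||]//=.
- case: (\int[lam2]_h H h)%E => [h||]//= _ [E]; rewrite !lee_fin; lra.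
- case: (\int[lam2]_h H h)%E => [h||]//=.
Qed.

End plane_measure.

(** * Area of truncated annuli around the unit circle *)

Section annulus.
Variable R : realType.
Implicit Types (u v w y : R * R) (s t k : R).
Local Notation leb := (@lebesgue_measure R).
Local Notation lam2 := (@lam2 R).

Lemma lam2_disc_le s : 0 <= s -> (lam2 (disc s) <= (4 * s ^+ 2)%:E)%E.
Proof.
move=> s0; rewrite -lam2_box//; apply: le_measure.
- by rewrite inE; exact: measurable_disc.
- by rewrite inE; apply: measurableX.
- move=> u; rewrite /disc /nrm2/= => h.
  have h1 : u.1 ^+ 2 <= s ^+ 2 by have := sqr_ge0 u.2; lra.
  have h2 : u.2 ^+ 2 <= s ^+ 2 by have := sqr_ge0 u.1; lra.
  by split; rewrite /= in_itv/= -ler_norml -ler_sqr ?nnegrE// real_normK// num_real.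
Qed.

Lemma lam2_disc s : 0 < s -> lam2 (disc s) = ((s ^+ 2)%:E * lam2 (@disc R 1))%E.
Proof.
move=> s0; rewrite -(lam2_scale s0 (measurable_disc (R := R) s)); congr (_ * lam2 _)%E.
have H q : (s ^+ 2 * q < s ^+ 2) = (q < 1).
  by rewrite -[ltRHS]mulr1 ltr_pM2l// exprn_gt0.
by apply/seteqP; split => u; rewrite /disc /nrm2/= expr1n !exprMn -mulrDr H.
Qed.

Definition annulus t : set (R * R) :=
  [set y | (nrm2 y <= 4) && (`|Num.sqrt (nrm2 y) - 1| <= t)].

Lemma measurable_annulus t : measurable (annulus t).
Proof.
apply: measurable_setb; apply: measurable_and.
  by apply: measurable_fun_ler => //; exact: measurable_nrm2.
apply: measurable_fun_ler => //; apply: measurableT_comp => //.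
apply: measurable_funB => //.
apply: (measurableT_comp _ (@measurable_nrm2 R)).
by apply: continuous_measurable_fun; exact: sqrt_continuous.
Qed.

(** The cut-off [nrm2 y <= 4] makes the bound linear for all [t]: beyond 1/2 the area 16 of a square
    is enough. Below 1/2 the annulus lies between the discs of radii [1 - 2 * t] and [1 + 2 * t],
    doubled because discs are open; by scaling their areas differ by [8 * t] times that of the unit
    disc, which is at most 4. *)
Lemma lam2_annulus_le t : 0 < t -> (lam2 (annulus t) <= (32 * t)%:E)%E.
Proof.
move=> t0; have [th|th] := ltP t (1/2); last first.
  apply: (@le_trans _ _ (lam2 (`[- 2, 2] `*` `[- 2, 2]))).
    apply: le_measure.
    - by rewrite inE; exact: measurable_annulus.
    - by rewrite inE; apply: measurableX.
    - move=> u; rewrite /annulus /nrm2/= => /andP[h _].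
      have h1 : u.1 ^+ 2 <= 2 ^+ 2 by have := sqr_ge0 u.2; lra.
      have h2 : u.2 ^+ 2 <= 2 ^+ 2 by have := sqr_ge0 u.1; lra.
      by split; rewrite /= in_itv/= -ler_norml -ler_sqr ?nnegrE// real_normK// num_real.
  by rewrite lam2_box// lee_fin; lra.
have a0 : 0 < 1 - 2 * t by lra.
have b0 : 0 < 1 + 2 * t by lra.
have dfin s : 0 <= s -> (lam2 (disc s) < +oo)%E.
  by move=> s0; apply: le_lt_trans (lam2_disc_le s0) _; exact: ltry.
apply: (@le_trans _ _ (lam2 (disc (1 + 2 * t) `\` disc (1 - 2 * t)))).
  apply: le_measure.
  - by rewrite inE; exact: measurable_annulus.
  - by rewrite inE; apply: measurableD; exact: measurable_disc.
  - move=> u; rewrite /annulus /disc/= => /andP[_].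
    rewrite ler_norml => /andP[h1 h2].
    have n0 : 0 <= Num.sqrt (nrm2 u) by exact: sqrtr_ge0.
    rewrite -(sqr_sqrtr (nrm2_ge0 u)); move: n0 h1 h2; set q := Num.sqrt _ => n0 h1 h2.
    clear -t0 a0 n0 h1 h2.
    split; first by nra.
    by apply/negP; rewrite -leNgt; nra.
rewrite measureD//=; [|exact: measurable_disc..|exact/dfin/ltW].
have -> : disc (1 + 2 * t) `&` disc (1 - 2 * t) = @disc R (1 - 2 * t).
  apply/seteqP; split => u; rewrite /disc/= => h; first by case: h.
  split => //; apply: lt_le_trans h _; rewrite -subr_ge0.
  have -> : (1 + 2 * t) ^+ 2 - (1 - 2 * t) ^+ 2 = 8 * t by ring.
  lra.
rewrite (lam2_disc b0) (lam2_disc a0).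
have := dfin 1 ler01; have := lam2_disc_le ler01.
have : (0 <= lam2 (@disc R 1))%E by exact: measure_ge0.
case: (lam2 (@disc R 1)) => [D| |]//= D0 D4 _.
rewrite -!EFinM -EFinB lee_fin; move: D0 D4; rewrite !lee_fin expr1n mulr1 => D0 D4.
have -> : (1 + 2 * t) ^+ 2 * D - (1 - 2 * t) ^+ 2 * D = 8 * t * D by ring.
have -> : 32 * t = 8 * t * 4 by ring.
by rewrite ler_wpM2l//; lra.
Qed.

End annulus.

(** * Adding one independent Gaussian term to a regression *)

Section regression.
Variable R : realType.
Local Notation leb := (@lebesgue_measure R).
Local Notation lam2 := (@lam2 R).
Implicit Types (u v w y c : R * R) (s t k : R).

Definition csub u v : R * R := (u.1 - v.1, u.2 - v.2).

Lemma measurable_csub d (T : measurableType d) (f g : T -> R * R) :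
  measurable_fun [set: T] f -> measurable_fun [set: T] g ->
  measurable_fun [set: T] (fun x => csub (f x) (g x)).
Proof.
by move=> mf mg; apply: measurable_fun_pair; apply: measurable_funB;
  (exact: measurable_fun_fst || exact: measurable_fun_snd).
Qed.

Lemma measurable_integral_lam2 d (E : measurableType d) (G : E * (R * R) -> \bar R) :
  measurable_fun [set: E * (R * R)] G -> (forall p, 0 <= G p)%E ->
  measurable_fun [set: E] (fun x => \int[lam2]_g G (x, g))%E.
Proof.
pose X2 : measurableType _ := (measurableTypeR R * measurableTypeR R)%type.
pose G' : E * X2 -> \bar R := G.
move=> mG G0; have mG' : measurable_fun [set: E * X2] G' by exact: mG.
exact: (@measurable_fun_fubini_tonelli_F _ _ E X2 R lam2 G' mG' G0).
Qed.

Lemma tonelli_swap (F : (R * R) * (R * R) -> \bar R) :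
  measurable_fun [set: (R * R) * (R * R)] F -> (forall x, 0 <= F x)%E ->
  (\int[lam2]_x \int[lam2]_y F (x, y) = \int[lam2]_y \int[lam2]_x F (x, y))%E.
Proof.
move=> mF F0.
have := @fubini_tonelli1 _ _ _ _ _ lam2 lam2 F mF F0.
by have := @fubini_tonelli2 _ _ _ _ _ lam2 lam2 F mF F0 => -> .
Qed.

Lemma lam2_cadd z (h : R * R -> \bar R) :
  measurable_fun [set: R * R] h -> (forall x, 0 <= h x)%E ->
  (\int[lam2]_x h (cadd x z) = \int[lam2]_x h x)%E.
Proof. exact: lam2_translate. Qed.

(** Let [x] have variance [K], let [g] be standard, and put [y = x + g u]. Then [rcoef] is the
    coefficient [conj(u) / (K + |u|^2)] of the regression of [g] on [y]. Substituting
    [g = h + y * rcoef] in [c x + w0 + g w] gives [rc * y + w0 + rkap * h], where [h] is the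
    residual. *)
Definition rcoef (K : R) u : R * R :=
  (u.1 / (K + nrm2 u), - u.2 / (K + nrm2 u)).
Definition rkap c u w : R * R := csub w (cmul c u).
Definition rc (K : R) c u w : R * R := cadd c (cmul (rcoef K u) (rkap c u w)).

(** In the coordinates [y] and [h] the joint density of [x] and [g] splits: [y] and [h] are
    independent, of variances [K + |u|^2] and [K / (K + |u|^2)]. *)
Lemma gpdf_complete_square (K : R) u y h : 0 < K ->
  let g := cadd h (cmul y (rcoef K u)) in
  gpdf K (csub y (cmul g u)) * gpdf 1 g =
  gpdf (K + nrm2 u) y * gpdf (K / (K + nrm2 u)) h.
Proof.
move=> K0 g; have K'0 : 0 < K + nrm2 u by rewrite ltr_pwDl// nrm2_ge0.
rewrite /gpdf mulrACA -expRD [RHS]mulrACA -expRD.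
have : 0 < pi :> R by exact: pi_gt0.
move: (pi : R) => p p0.
congr (_ * expR _); first by field; rewrite !gt_eqF.
move: K'0; rewrite /g /rcoef /csub /cadd /cmul /nrm2/=.
move: u y h {g} => [u1 u2] [y1 y2] [h1 h2]/= K'0.
by field; rewrite !gt_eqF.
Qed.

(** The passage from [(x, g)] to [(y, h)] is a composition of two shears. Each is a translation of
    one variable with the other fixed, so exchanging the integrals between them replaces a Jacobian
    computation. *)
Lemma gauss_regression (K : R) c u w w0 (f : (R * R) * (R * R) -> \bar R) : 0 < K ->
  measurable_fun [set: (R * R) * (R * R)] f -> (forall x, 0 <= f x)%E ->
  (\int[lam2]_x (\int[lam2]_g (f (cadd x (cmul g u), cadd (cadd (cmul c x) w0) (cmul g w)) *
       (gpdf 1 g)%:E) * (gpdf K x)%:E) =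
   \int[lam2]_h (\int[lam2]_y (f (y, cadd (cmul (rc K c u w) y) (cadd w0 (cmul (rkap c u w) h))) *
       (gpdf (K + nrm2 u) y)%:E) * (gpdf (K / (K + nrm2 u)) h)%:E))%E.
Proof.
move=> K0 mf f0.
have K'0 : 0 < K + nrm2 u by rewrite ltr_pwDl// nrm2_ge0.
have KK0 : 0 <= K / (K + nrm2 u) by rewrite divr_ge0// ltW.
have m1 : measurable_fun [set: (R * R) * (R * R)] fst by exact: measurable_fst.
have m2 : measurable_fun [set: (R * R) * (R * R)] snd by exact: measurable_snd.
have mc z : measurable_fun [set: (R * R) * (R * R)] (fun=> z : R * R) by exact: measurable_cst.
pose F (p : (R * R) * (R * R)) := (f (cadd p.1 (cmul p.2 u),
  cadd (cadd (cmul c p.1) w0) (cmul p.2 w)) * (gpdf 1 p.2 * gpdf K p.1)%:E)%E.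
have mF : measurable_fun [set: (R * R) * (R * R)] F.
  apply: emeasurable_funM.
    apply: (measurableT_comp mf); apply: measurable_fun_pair.
      by apply: measurable_cadd => //; exact: measurable_cmul.
    apply: measurable_cadd; last exact: measurable_cmul.
    by apply: measurable_cadd => //; exact: measurable_cmul.
  apply/measurable_EFinP; apply: measurable_funM.
    by apply: measurableT_comp m2; exact: measurable_gpdf.
  by apply: measurableT_comp m1; exact: measurable_gpdf.
have F0 p : (0 <= F p)%E.
  by rewrite mule_ge0// lee_fin mulr_ge0// gpdf_ge0// ltW.
pose F1 (p : (R * R) * (R * R)) := F (csub p.1 (cmul p.2 u), p.2).
have mF1 : measurable_fun [set: (R * R) * (R * R)] F1.
  apply: (measurableT_comp mF); apply: measurable_fun_pair => //.
  by apply: measurable_csub => //; exact: measurable_cmul.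
pose F2 (p : (R * R) * (R * R)) := F1 (p.1, cadd p.2 (cmul p.1 (rcoef K u))).
have mF2 : measurable_fun [set: (R * R) * (R * R)] F2.
  apply: (measurableT_comp mF1); apply: measurable_fun_pair => //.
  by apply: measurable_cadd => //; exact: measurable_cmul.
have mslice1 (G : (R * R) * (R * R) -> \bar R) y : measurable_fun setT G ->
    measurable_fun [set: R * R] (fun x => G (x, y)).
  by move=> mG; exact: measurableT_comp.
have mslice2 (G : (R * R) * (R * R) -> \bar R) y : measurable_fun setT G ->
    measurable_fun [set: R * R] (fun x => G (y, x)).
  by move=> mG; exact: measurableT_comp.
transitivity (\int[lam2]_x \int[lam2]_g F (x, g))%E.
  apply: eq_integral => x _; rewrite -ge0_integralZr//.
  - by apply: eq_integral => g _; rewrite /F/= (EFinM (gpdf 1 g)) muleA.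
  - apply: emeasurable_funM.
      apply: (measurableT_comp mf); apply: measurable_fun_pair.
        apply: measurable_cadd; first exact: measurable_cst.
        by apply: measurable_cmul => //; exact: measurable_cst.
      apply: measurable_cadd; first exact: measurable_cst.
      by apply: measurable_cmul => //; exact: measurable_cst.
    by apply/measurable_EFinP; exact: measurable_gpdf.
  - by move=> g _; rewrite mule_ge0// lee_fin gpdf_ge0.
  - by rewrite lee_fin gpdf_ge0// ltW.
rewrite tonelli_swap//.
transitivity (\int[lam2]_g \int[lam2]_y F1 (y, g))%E.
  apply: eq_integral => g _.
  by rewrite -(@lam2_cadd (- (cmul g u).1, - (cmul g u).2)%R (fun x => F (x, g)) (mslice1 F g mF) (fun=> F0 _)).
rewrite -tonelli_swap//; last by move=> p; exact: F0.
transitivity (\int[lam2]_y \int[lam2]_h F2 (y, h))%E.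
  apply: eq_integral => y _.
  by rewrite -(@lam2_cadd (cmul y (rcoef K u)) (fun g => F1 (y, g)) (mslice2 F1 y mF1) (fun=> F0 _)).
rewrite tonelli_swap//; last by move=> p; exact: F0.
apply: eq_integral => h _; rewrite -ge0_integralZr//; first last.
- by rewrite lee_fin gpdf_ge0.
- by move=> y _; rewrite mule_ge0// lee_fin gpdf_ge0// ltW.
- apply: emeasurable_funM; last by apply/measurable_EFinP; exact: measurable_gpdf.
  apply: (measurableT_comp mf); apply: measurable_fun_pair => //.
  apply: measurable_cadd; last exact: measurable_cst.
  by apply: measurable_cmul => //; exact: measurable_cst.
apply: eq_integral => y _.
rewrite /F2 /F1 /F/= mulrC gpdf_complete_square// (EFinM (gpdf _ y)) muleA; congr (f (_, _) * _ * _)%E.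
- by rewrite /csub /cadd/=; case: y => y1 y2/=; congr pair; ring.
- rewrite /rc /rkap; move: (rcoef K u) => b.
  by rewrite /csub /cadd /cmul/=; congr pair; ring.
Qed.

End regression.

(** Rectangles form a pi-system containing the whole space. *)
Lemma finite_measure_prod_unique d1 d2 (T1 : measurableType d1)
    (T2 : measurableType d2) (R : realType)
    (m1 m2 : {measure set (T1 * T2) -> \bar R}) :
  (m1 setT < +oo)%E ->
  (forall A B, measurable A -> measurable B -> m1 (A `*` B) = m2 (A `*` B)) ->
  forall X, measurable X -> m1 X = m2 X.
Proof.
move=> m1oo m12 X mX.
pose G : set (set (T1 * T2)) := [set C | exists A B, [/\ measurable A, measurable B & C = A `*` B]].
apply: (@measure_unique _ _ _ G (fun=> setT)) => //.
- rewrite measurable_prod_measurableType; congr (<<s _ >>).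
  apply/seteqP; split => C /=.
    by move=> [A mA [B mB <-]]; exists A, B.
  by move=> [A [B [mA mB ->]]]; exists A => //; exists B.
- move=> _ _ [A [B [mA mB ->]]] [A' [B' [mA' mB' ->]]].
  exists (A `&` A'), (B `&` B'); split; [exact: measurableI..|].
  by rewrite setXI.
- by move=> _; exists setT, setT; split => //; rewrite setXTT.
- by rewrite bigcup_const.
- by move=> _ [A [B [mA mB ->]]]; exact: m12.
Qed.

(** * Linear combinations of independent Gaussian coefficients *)

Section gaussian_sums.
Context (R : realType) (d : measure_display) (T : measurableType d).
Variables (P : probability T R) (n : nat) (A : 'I_n.+1 -> T -> R * R).
Local Notation lam2 := (@lam2 R).
Hypothesis mA : forall k, measurable_fun [set: T] (A k).
Hypothesis lawA : forall k (B : set (R * R)), measurable B ->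
  (P (A k @^-1` B) = \int[lam2]_(y in B) (gpdf 1 y)%:E)%E.
Hypothesis indA : forall (J : {set 'I_n.+1}) (B : 'I_n.+1 -> set (R * R)),
  (forall j, measurable (B j)) ->
  (P (\bigcap_(j in [set` J]) (A j @^-1` B j)) = \prod_(j in J) P (A j @^-1` B j))%E.

(** Events about the coefficients still to be added. They are intersections over a single index set,
    so that [indA] applies as it stands. *)
Let D m (B : 'I_n.+1 -> set (R * R)) : set T :=
  \bigcap_(j in [set` [set j : 'I_n.+1 | (m <= j)%N]%SET]) (A j @^-1` B j).

Let measurable_pre k B : measurable B -> measurable (A k @^-1` B).
Proof. by move=> mB; rewrite -[X in measurable X]setTI; exact: mA. Qed.

Let measurable_D m B : (forall j, measurable (B j)) -> measurable (D m B).
Proof. by move=> mB; apply: fin_bigcap_measurable => // j _; exact: measurable_pre. Qed.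

Let D_split (m : 'I_n.+1) B0 B :
  D m (fun j => if j == m then B0 else B j) = A m @^-1` B0 `&` D m.+1 B.
Proof.
apply/seteqP; split => t.
  move=> h; split; first by have := h m; rewrite /= inE leqnn eqxx; exact.
  move=> j /=; rewrite inE => mj; have := h j; rewrite /= inE (ltnW mj) => /(_ erefl).
  by case: eqP => // jm; move: mj; rewrite jm ltnn.
move=> [h0 h] j /=; rewrite inE => mj; case: eqP => [->//|/eqP jm].
by apply: h => /=; rewrite inE ltn_neqAle eq_sym jm.
Qed.

Let prob_D_split (m : 'I_n.+1) B0 B : measurable B0 -> (forall j, measurable (B j)) ->
  P (A m @^-1` B0 `&` D m.+1 B) = (P (A m @^-1` B0) * P (D m.+1 B))%E.
Proof.
move=> mB0 mB; rewrite -D_split /D indA; last by move=> j; case: ifP.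
rewrite indA// (bigD1 m)/=; last by rewrite inE.
rewrite eqxx; congr (_ * _)%E; apply: eq_big => j.
  by rewrite !inE ltn_neqAle andbC eq_sym.
by move=> /andP[_ /negbTE ->].
Qed.

Let D_setT m : D m (fun=> setT) = setT.
Proof. by rewrite /D; apply/seteqP; split => t. Qed.

(* [lam2] lives on the product of two [measurableTypeR R], whose display differs
   from that of [R * R]; hence the detour through [X2]. *)
Lemma integral_gaussian k (h : R * R -> \bar R) :
  measurable_fun [set: R * R] h -> (forall y, 0 <= h y)%E ->
  (\int[P]_t h (A k t) = \int[lam2]_y (h y * (gpdf 1 y)%:E))%E.
Proof.
move=> mh h0.
pose X2 : measurableType _ := (measurableTypeR R * measurableTypeR R)%type.
pose Ak : T -> X2 := A k.
have mAk : measurable_fun [set: T] Ak by exact: mA.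
pose A' : {mfun T >-> X2} := mfun_Sub (mem_set mAk).
pose muA : probability X2 R := distribution P A'.
rewrite -(@ge0_integral_density _ _ _ muA lam2 (gpdf 1) (@measurable_gpdf R 1)
  (fun y => gpdf_ge0 y ler01) (fun B mB => lawA k mB) _ mh h0).
by rewrite /muA /= ge0_integral_pushforward.
Qed.

(** Independence from all the remaining coefficients, not merely from the next one: this is what
    passes from [m] to [m.+1]. *)
Definition indep_of_rest d' (E : measurableType d') (S : T -> E) m : Prop :=
  forall C B, measurable C -> (forall j, measurable (B j)) ->
  P (S @^-1` C `&` D m B) = (P (S @^-1` C) * P (D m B))%E.

Section step.
Context d' (E : measurableType d') (S : T -> E) (m : 'I_n.+1).
Hypothesis mS : measurable_fun [set: T] S.
Hypothesis iS : indep_of_rest S m.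

Let SA (t : T) := (S t, A m t).

Let mSA : measurable_fun [set: T] SA.
Proof. exact: measurable_fun_pair. Qed.

Let rect_ind C B0 B : measurable C -> measurable B0 -> (forall j, measurable (B j)) ->
  P (SA @^-1` (C `*` B0) `&` D m.+1 B) =
  (P (S @^-1` C) * P (A m @^-1` B0) * P (D m.+1 B))%E.
Proof.
move=> mC mB0 mB.
have -> : SA @^-1` (C `*` B0) `&` D m.+1 B = S @^-1` C `&` (A m @^-1` B0 `&` D m.+1 B).
  by rewrite setIA.
rewrite -D_split iS//; last by move=> j; case: ifP.
by rewrite D_split prob_D_split// muleA.
Qed.

Let rect_ind0 C B0 : measurable C -> measurable B0 ->
  P (SA @^-1` (C `*` B0)) = (P (S @^-1` C) * P (A m @^-1` B0))%E.
Proof.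
move=> mC mB0; have := @rect_ind C B0 (fun=> setT) mC mB0 (fun=> measurableT).
by rewrite D_setT setIT probability_setT mule1.
Qed.

(** For fixed [B], the law of [(S, A m)] restricted to [D m.+1 B] and the same law multiplied by the
    probability of [D m.+1 B] agree on rectangles, hence on the preimage of [C] under [phi]. *)
Lemma indep_of_rest_step d'' (E' : measurableType d'') (phi : E * (R * R) -> E') :
  measurable_fun [set: E * (R * R)] phi ->
  indep_of_rest (fun t => phi (S t, A m t)) m.+1.
Proof.
move=> mphi C B mC mB.
have mphiC : measurable (phi @^-1` C) by rewrite -[X in measurable X]setTI; exact: mphi.
have mDB := @measurable_D m.+1 B mB.
pose m1 : {measure set (E * (R * R)) -> \bar R} := pushforward (mrestr P mDB) SA.
have PD0 : 0 <= fine (P (D m.+1 B)) by rewrite fine_ge0.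
pose m2 : {measure set (E * (R * R)) -> \bar R} :=
  mscale (NngNum PD0) (pushforward P SA).
have PDE : (fine (P (D m.+1 B)))%:E = P (D m.+1 B).
  by rewrite fineK// fin_num_measure.
have := @finite_measure_prod_unique _ _ _ _ _ (m1 mSA) (m2 mSA) _ _ _ mphiC.
rewrite /m1 /m2 /= /mscale /= /pushforward /mrestr /= PDE => ->.
- by rewrite muleC.
- rewrite preimage_setT setTI; apply: le_lt_trans (probability_le1 _ _) _ => //.
  by rewrite ltry.
- move=> C0 B0 mC0 mB0; rewrite rect_ind// rect_ind0//.
  by rewrite [RHS]muleC.
Qed.

(** The law of [(S, A m)] is the product of its marginals, so the new coefficient can be integrated
    first, against its density. *)
Lemma indep_integral (F : E * (R * R) -> \bar R) :
  measurable_fun [set: E * (R * R)] F -> (forall x, 0 <= F x)%E ->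
  (\int[P]_t F (S t, A m t) =
   \int[P]_t \int[lam2]_g (F (S t, g) * (gpdf 1 g)%:E))%E.
Proof.
move=> mF F0.
pose S' : {mfun T >-> E} := mfun_Sub (mem_set mS).
pose X2 : measurableType _ := (measurableTypeR R * measurableTypeR R)%type.
pose Am : T -> X2 := A m.
pose SAm : T -> E * X2 := SA.
have mA' : measurable_fun [set: T] Am by exact: mA.
have mF' : measurable_fun [set: E * X2] F by exact: mF.
have mSA' : measurable_fun [set: T] SAm by exact: mSA.
pose A' : {mfun T >-> X2} := mfun_Sub (mem_set mA').
pose muS : probability E R := distribution P S'.
pose muA : probability X2 R := distribution P A'.
pose mu : {measure set (E * X2) -> \bar R} := pushforward P SAm.
have muE : forall X, measurable X -> (mu mSA') X = (muS \x muA)%E X.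
  apply: finite_measure_prod_unique => /=.
  - rewrite /mu /= /pushforward preimage_setT; apply: le_lt_trans (probability_le1 _ _) _ => //.
    by rewrite ltry.
  - move=> C0 B0 mC0 mB0; rewrite /mu /= product_measure1E//= /pushforward.
    exact: rect_ind0.
transitivity (\int[mu mSA']_x F x)%E.
  by rewrite /mu /= ge0_integral_pushforward.
rewrite (eq_measure_integral (muS \x muA)%E); last by move=> X mX _; exact: muE.
rewrite fubini_tonelli1//.
transitivity (\int[muS]_x \int[lam2]_g (F (x, g) * (gpdf 1 g)%:E))%E.
  apply: eq_integral => x _; rewrite /fubini_F.
  have mFx : measurable_fun [set: X2] (fun g => F (x, g)).
    by apply: (measurableT_comp mF'); exact: measurable_fun_pair.
  exact: (@ge0_integral_density _ _ _ muA lam2 (gpdf 1) (@measurable_gpdf R 1)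
    (fun y => gpdf_ge0 y ler01) (fun B mB => lawA m mB) _ mFx (fun=> F0 _)).
rewrite /muS /= ge0_integral_pushforward//.
- pose G (p : E * (R * R)) := (F p * (gpdf 1 p.2)%:E)%E.
  apply: (measurable_integral_lam2 (G := G)).
  + apply: emeasurable_funM => //; apply/measurable_EFinP.
    by apply: (measurableT_comp _ measurable_snd); exact: measurable_gpdf.
  + by move=> p; rewrite mule_ge0// lee_fin gpdf_ge0.
- by move=> x _; apply: integral_ge0 => g _; rewrite mule_ge0// lee_fin gpdf_ge0.
Qed.

End step.

Implicit Types (u w c : R * R).

(* What is kept of the regression, namely that S.1 is Gaussian of variance K and
   that S.2 - c S.1 is independent of S.1 with second moment at most v.  The law of S.2 - c S.1 is
   never described: only quadratic upper bounds of the conditional expectation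
   given its value w0 are integrated. *)
Definition sub_gaussian_bound (S : T -> (R * R) * (R * R)) (K : R) c (v : R) : Prop :=
  forall f : (R * R) * (R * R) -> \bar R,
  measurable_fun [set: (R * R) * (R * R)] f -> (forall x, 0 <= f x)%E ->
  forall alpha beta, 0 <= alpha -> 0 <= beta ->
  (forall w0, \int[lam2]_y (f (y, cadd (cmul c y) w0) * (gpdf K y)%:E) <=
     (alpha + beta * nrm2 w0)%:E)%E ->
  (\int[P]_t f (S t) <= (alpha + beta * v)%:E)%E.

(** After the regression the residual is [w0 + rkap * h]. Averaging a quadratic bound over [h] gives
    again a quadratic bound in [w0], with the same [beta] and a larger [alpha], to which the
    hypothesis on [S] applies. The factor 4 is that of [integral_nrm2_gpdf]. *)
Lemma sub_gaussian_bound_step (m : 'I_n.+1) S K c v u w : 0 < K ->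
  measurable_fun [set: T] S -> indep_of_rest S m ->
  sub_gaussian_bound S K c v ->
  sub_gaussian_bound
    (fun t => (cadd (S t).1 (cmul (A m t) u), cadd (S t).2 (cmul (A m t) w)))
    (K + nrm2 u) (rc K c u w) (v + 4 * (K / (K + nrm2 u)) * nrm2 (rkap c u w)).
Proof.
move=> K0 mS iS bS f mf f0 alpha beta a0 b0 hf.
have K'0 : 0 < K + nrm2 u by rewrite ltr_pwDl// nrm2_ge0.
have k0 : 0 < K / (K + nrm2 u) by rewrite divr_gt0.
pose Phi (p : ((R * R) * (R * R)) * (R * R)) : (R * R) * (R * R) :=
  (cadd p.1.1 (cmul p.2 u), cadd p.1.2 (cmul p.2 w)).
have mPhi : measurable_fun setT Phi.
  have m1 : measurable_fun [set: ((R * R) * (R * R)) * (R * R)] fst by exact: measurable_fst.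
  have m2 : measurable_fun [set: ((R * R) * (R * R)) * (R * R)] snd by exact: measurable_snd.
  apply: measurable_fun_pair; apply: measurable_cadd.
  - exact: (measurableT_comp measurable_fst m1).
  - by apply: measurable_cmul => //; exact: measurable_cst.
  - exact: (measurableT_comp measurable_snd m1).
  - by apply: measurable_cmul => //; exact: measurable_cst.
pose F p := f (Phi p).
have mF : measurable_fun setT F by exact: measurableT_comp.
have F0 p : (0 <= F p)%E by exact: f0.
rewrite -[leLHS]/(\int[P]_t F (S t, A m t))%E (indep_integral mS iS mF)//.
pose G p := (\int[lam2]_g (F (p, g) * (gpdf 1 g)%:E))%E.
have mG : measurable_fun [set: (R * R) * (R * R)] G.
  pose H (p : ((R * R) * (R * R)) * (R * R)) := (F p * (gpdf 1 p.2)%:E)%E.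
  apply: (measurable_integral_lam2 (G := H)).
  - apply: emeasurable_funM => //; apply/measurable_EFinP.
    by apply: (measurableT_comp _ measurable_snd); exact: measurable_gpdf.
  - by move=> p; rewrite mule_ge0// lee_fin gpdf_ge0.
have G0 p : (0 <= G p)%E.
  by apply: integral_ge0 => g _; rewrite mule_ge0// lee_fin gpdf_ge0.
rewrite mulrDr addrA.
have -> : alpha + beta * v + beta * (4 * (K / (K + nrm2 u)) * nrm2 (rkap c u w)) =
  alpha + beta * (4 * (K / (K + nrm2 u)) * nrm2 (rkap c u w)) + beta * v by ring.
apply: (bS G mG G0) => //.
  by rewrite addr_ge0// mulr_ge0// mulr_ge0 ?nrm2_ge0// mulr_ge0// ltW.
move=> w0; rewrite /G /F /Phi/= gauss_regression//.
have -> : alpha + beta * (4 * (K / (K + nrm2 u)) * nrm2 (rkap c u w)) + beta * nrm2 w0 =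
  alpha + beta * nrm2 w0 + beta * (4 * (K / (K + nrm2 u)) * nrm2 (rkap c u w)) by ring.
apply: le_trans (integral_affine_nrm2 w0 (rkap c u w) k0 a0 b0).
have mcst z : measurable_fun [set: R * R] (fun=> z : R * R) by exact: measurable_cst.
have mker : measurable_fun [set: R * R] (fun h => cadd w0 (cmul (rkap c u w) h)).
  apply: measurable_cadd; first exact: mcst.
  by apply: measurable_cmul; first exact: mcst.
apply: ge0_le_integral => //.
- move=> h _; rewrite mule_ge0// ?lee_fin ?gpdf_ge0 ?(ltW k0)//.
  by apply: integral_ge0 => y _; rewrite mule_ge0// lee_fin gpdf_ge0// ltW.
- apply: emeasurable_funM; last by apply/measurable_EFinP; exact: measurable_gpdf.
  pose H (p : (R * R) * (R * R)) := (f (p.2, cadd (cmul (rc K c u w) p.2)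
    (cadd w0 (cmul (rkap c u w) p.1))) * (gpdf (K + nrm2 u) p.2)%:E)%E.
  apply: (measurable_integral_lam2 (G := H)).
  + have m1 : measurable_fun [set: (R * R) * (R * R)] fst by exact: measurable_fst.
    have m2 : measurable_fun [set: (R * R) * (R * R)] snd by exact: measurable_snd.
    apply: emeasurable_funM.
      apply: (measurableT_comp mf); apply: measurable_fun_pair => //.
      apply: measurable_cadd.
        by apply: measurable_cmul => //; exact: measurable_cst.
      exact: (measurableT_comp mker m1).
    apply/measurable_EFinP; apply: (measurableT_comp _ m2); exact: measurable_gpdf.
  + by move=> p; rewrite mule_ge0// lee_fin gpdf_ge0// ltW.
- apply/measurable_EFinP; apply: measurable_funM; last exact: measurable_gpdf.
  apply: measurable_funD => //; apply: measurable_funM => //.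
  by apply: (measurableT_comp _ mker); exact: measurable_nrm2.
- move=> h _; rewrite [leRHS]EFinM lee_wpmul2r ?lee_fin ?gpdf_ge0 ?(ltW k0)//.
Qed.

(** Pythagoras: the variance of the second sum after adding [g w] is shared between the part
    explained by the new regression and the new residual. *)
Lemma regression_energy K c u w : 0 < K ->
  nrm2 (rc K c u w) * (K + nrm2 u) + K / (K + nrm2 u) * nrm2 (rkap c u w) =
  nrm2 c * K + nrm2 w.
Proof.
move=> K0; have : 0 < K + nrm2 u by rewrite ltr_pwDl// nrm2_ge0.
rewrite /rc /rcoef /rkap /csub /cadd /cmul /nrm2/=.
case: u c w => [u1 u2] [c1 c2] [w1 w2]/= h.
by field; rewrite gt_eqF.
Qed.

Variables (u w : nat -> R * R).

(** For [u k = z^k] and [w k = k z^(k-1)] these are the partial sums of the pair [(p(z), p'(z))]. *)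
Fixpoint gsum m (t : T) : (R * R) * (R * R) :=
  if m is k.+1 then
    (cadd (gsum k t).1 (cmul (A (inord k) t) (u k)),
     cadd (gsum k t).2 (cmul (A (inord k) t) (w k)))
  else ((0, 0), (0, 0)).

Lemma measurable_gsum m : measurable_fun [set: T] (gsum m).
Proof.
elim: m => [|m ih] /=; first exact: measurable_cst.
apply: measurable_fun_pair; apply: measurable_cadd.
- exact: measurableT_comp.
- by apply: measurable_cmul => //; exact: measurable_cst.
- exact: measurableT_comp.
- by apply: measurable_cmul => //; exact: measurable_cst.
Qed.

Lemma gsum_indep m : (m <= n.+1)%N -> indep_of_rest (gsum m) m.
Proof.
elim: m => [_|m ih mn] C B mC mB.
  have [h|h] := pselect (C ((0, 0), (0, 0))).
    have -> : gsum 0 @^-1` C = setT by apply/seteqP; split.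
    by rewrite setTI probability_setT mul1e.
  have -> : gsum 0 @^-1` C = set0 by apply/seteqP; split.
  by rewrite set0I measure0 mul0e.
have im : @inord n m = m :> nat by rewrite inordK.
have ih' := ih (ltnW mn); rewrite -im in ih'.
pose phi (p : ((R * R) * (R * R)) * (R * R)) : (R * R) * (R * R) :=
  (cadd p.1.1 (cmul p.2 (u m)), cadd p.1.2 (cmul p.2 (w m))).
have mphi : measurable_fun setT phi.
  have m1 : measurable_fun [set: ((R * R) * (R * R)) * (R * R)] fst by exact: measurable_fst.
  have m2 : measurable_fun [set: ((R * R) * (R * R)) * (R * R)] snd by exact: measurable_snd.
  apply: measurable_fun_pair; apply: measurable_cadd.
  - exact: (measurableT_comp measurable_fst m1).
  - by apply: measurable_cmul => //; exact: measurable_cst.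
  - exact: (measurableT_comp measurable_snd m1).
  - by apply: measurable_cmul => //; exact: measurable_cst.
have := @indep_of_rest_step _ _ _ (inord m) (measurable_gsum _) ih' _ _ phi mphi C B mC mB.
by rewrite im.
Qed.

(** The constant coefficient starts the regression with variance 1, and it does not enter the
    derivative. *)
Hypotheses (u0 : u 0%N = (1, 0)) (w0 : w 0%N = (0, 0)).

(** The induction carries an energy inequality in place of formulas for [c] and [v]. Its factor 4
    matches the loss in each residual term, so [regression_energy] propagates it exactly. *)
Lemma gsum_bound m : (m <= n)%N -> exists c (v : R),
  [/\ 0 <= v,
   4 * (nrm2 c * \sum_(k < m.+1) nrm2 (u k)) + v <= 4 * \sum_(k < m.+1) nrm2 (w k) &
   sub_gaussian_bound (gsum m.+1) (\sum_(k < m.+1) nrm2 (u k)) c v].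
Proof.
elim: m => [_|m ih mn].
  exists (0, 0), 0; rewrite !big_ord1 u0 w0; split => //.
    by rewrite /nrm2/= expr1n !expr0n/=; lra.
  move=> f mf f0 alpha beta a0 b0 hf.
  have K1 : nrm2 (1, 0) = 1 :> R by rewrite /nrm2/= expr1n expr0n/= addr0.
  have K00 : nrm2 (0, 0) = 0 :> R by rewrite /nrm2/= expr0n/= addr0.
  have := hf (0, 0); rewrite K1 K00 !mulr0; apply: le_trans.
  pose h (y : R * R) := f (y, (0, 0)).
  have mh : measurable_fun [set: R * R] h.
    by apply: (measurableT_comp mf); apply: measurable_fun_pair => //; exact: measurable_cst.
  rewrite le_eqVlt; apply/orP; left; apply/eqP.
  transitivity (\int[lam2]_y (h y * (gpdf 1 y)%:E))%E; last first.
    by apply: eq_integral => y _; rewrite /h /cadd /cmul/= !mul0r subr0 !addr0.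
  rewrite -(integral_gaussian (inord 0) mh (fun=> f0 _)).
  apply: eq_integral => t _; congr (f _).
  by rewrite [gsum 1 t]/= u0 w0 /cadd /cmul/= !mulr0 !mulr1 subr0 !add0r oppr0 -surjective_pairing.
have [c [v [v0 hc hb]]] := ih (ltnW mn).
set K := \sum_(k < m.+1) nrm2 (u k) in hc hb.
have K0 : 0 < K.
  rewrite /K big_ord_recl/= u0 ltr_pwDl ?sumr_ge0// => [|i _]; last exact: nrm2_ge0.
  by rewrite /nrm2/= expr1n expr0n/= addr0.
exists (rc K c (u m.+1) (w m.+1)),
  (v + 4 * (K / (K + nrm2 (u m.+1))) * nrm2 (rkap c (u m.+1) (w m.+1))).
have EK : \sum_(k < m.+2) nrm2 (u k) = K + nrm2 (u m.+1) by rewrite big_ord_recr.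
have EV : \sum_(k < m.+2) nrm2 (w k) = \sum_(k < m.+1) nrm2 (w k) + nrm2 (w m.+1).
  by rewrite big_ord_recr.
rewrite EK EV; split.
- rewrite addr_ge0// mulr_ge0 ?nrm2_ge0// mulr_ge0// divr_ge0 ?ltW//.
  by rewrite ltr_pwDl// nrm2_ge0.
- have := regression_energy c (u m.+1) (w m.+1) K0; lra.
- have im : @inord n m.+1 = m.+1 :> nat by rewrite inordK.
  have iS : indep_of_rest (gsum m.+1) (@inord n m.+1) by rewrite im; apply: gsum_indep; exact: ltnW.
  exact: (sub_gaussian_bound_step K0 (@measurable_gsum m.+1) iS hb).
Qed.

Let K := \sum_(k < n.+1) nrm2 (u k).
Let V := \sum_(k < n.+1) nrm2 (w k).

Lemma sqrt_nrm2E (a : R * R) : Num.sqrt (nrm2 a) = Normc.normc (Complex a.1 a.2).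
Proof. by []. Qed.

Lemma sqrt_nrm2_cadd (a b : R * R) :
  Num.sqrt (nrm2 (cadd a b)) <= Num.sqrt (nrm2 a) + Num.sqrt (nrm2 b).
Proof.
rewrite !sqrt_nrm2E.
have := le_normcD (Complex a.1 a.2) (Complex b.1 b.2); exact.
Qed.

Lemma sqrt_nrm2_cmul (a b : R * R) :
  Num.sqrt (nrm2 (cmul a b)) = Num.sqrt (nrm2 a) * Num.sqrt (nrm2 b).
Proof.
rewrite !sqrt_nrm2E.
have := Normc.normcM (Complex a.1 a.2) (Complex b.1 b.2); exact.
Qed.

Lemma measurable_sqrt_nrm2 : measurable_fun [set: R * R] (fun y : R * R => Num.sqrt (nrm2 y)).
Proof.
apply: (measurableT_comp _ (@measurable_nrm2 R)).
by apply: continuous_measurable_fun; exact: sqrt_continuous.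
Qed.

(** With the residual fixed at [z0], the event forces [y], the value of the first sum, into the
    annulus of width [t = eta * (2 |c| + |z0| + 1)], since [|y| <= 2]. The annulus has area at most
    [32 * t], and the density of [y] is at most [1 / K]. This is linear in [|z0|]; the
    arithmetic-geometric inequality makes it quadratic, as [sub_gaussian_bound] requires. *)
Lemma gsum_annulus_bound eta : 0 < eta ->
  (P [set t | (nrm2 (gsum n.+1 t).1 <= 4)%R &&
     (`|Num.sqrt (nrm2 (gsum n.+1 t).1) - 1|%R <=
        eta * (Num.sqrt (nrm2 (gsum n.+1 t).2) + 1))%R]
   <= (192 * eta * (1 + Num.sqrt V) / K)%:E)%E.
Proof.
move=> eta0.
have [c [v [v0 hc hb]]] := gsum_bound (leqnn n); rewrite -/K -/V in hc hb.
have K1 : 1 <= K.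
  rewrite /K big_ord_recl/= u0 ; apply: (@le_trans _ _ (nrm2 (1, 0) : R)).
    by rewrite /nrm2/= expr1n expr0n/= addr0.
  by rewrite lerDl; apply: sumr_ge0 => i _; exact: nrm2_ge0.
have K0 : 0 < K by apply: lt_le_trans K1.
have V0 : 0 <= V by apply: sumr_ge0 => i _; exact: nrm2_ge0.
set s := 1 + Num.sqrt V.
have s1 : 1 <= s by rewrite lerDl sqrtr_ge0.
have s0 : 0 < s by apply: lt_le_trans s1.
have Vs : V <= s ^+ 2.
  by rewrite /s -{1}(sqr_sqrtr V0); have := sqrtr_ge0 V; nra.
have ncV : nrm2 c <= V by have := nrm2_ge0 c; nra.
have cs : Num.sqrt (nrm2 c) <= s.
  by apply: (@le_trans _ _ (Num.sqrt V)); [rewrite ler_sqrt|rewrite lerDr].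
have vs : v <= 4 * s ^+ 2 by have := nrm2_ge0 c; nra.
pose E : set ((R * R) * (R * R)) := [set p | (nrm2 p.1 <= 4) &&
  (`|Num.sqrt (nrm2 p.1) - 1| <= eta * (Num.sqrt (nrm2 p.2) + 1))].
have m1 : measurable_fun [set: (R * R) * (R * R)] fst by exact: measurable_fst.
have m2 : measurable_fun [set: (R * R) * (R * R)] snd by exact: measurable_snd.
have mE : measurable E.
  apply: measurable_setb; apply: measurable_and.
    by apply: measurable_fun_ler => //; exact: (measurableT_comp (@measurable_nrm2 R) m1).
  apply: measurable_fun_ler.
    apply: measurableT_comp => //; apply: measurable_funB => //.
    exact: (measurableT_comp measurable_sqrt_nrm2 m1).
  apply: measurable_funM => //; apply: measurable_funD => //.
  exact: (measurableT_comp measurable_sqrt_nrm2 m2).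
pose f p : \bar R := (\1_E p)%:E.
have mf : measurable_fun setT f by apply/measurable_EFinP; exact: measurable_indic.
have f0 p : (0 <= f p)%E by rewrite lee_fin.
(* These come from [r <= s / 2 + r ^+ 2 / (2 * s)], weighted by [s = 1 + sqrt V] because the
   residual has typical size at most a multiple of [s]. *)
pose alpha := 32 * eta / K * (2 * Num.sqrt (nrm2 c) + 1 + s / 2).
pose beta := 32 * eta / K / (2 * s).
have eK0 : 0 <= 32 * eta / K by rewrite divr_ge0 ?(ltW K0)// mulr_ge0// ltW.
have a0 : 0 <= alpha.
  rewrite mulr_ge0// addr_ge0 ?divr_ge0 ?(ltW s0)// addr_ge0// mulr_ge0// sqrtr_ge0.
have b0 : 0 <= beta by rewrite divr_ge0// mulr_ge0// ltW.
have := hb f mf f0 alpha beta a0 b0.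
have -> : (\int[P]_t f (gsum n.+1 t) = P (gsum n.+1 @^-1` E))%E.
  have mgE : measurable (gsum n.+1 @^-1` E).
    by rewrite -[X in measurable X]setTI; exact: measurable_gsum.
  rewrite -[X in _ = P X]setIT -integral_indic//; apply: eq_integral => t _.
move=> H; apply: le_trans (H _) _; last first.
  (* The four terms use [|c| <= s], [1 <= s] and [v / (2 * s) <= 2 * s]; their sum is rounded up to
     [6 * s], whence 192 = 32 * 6. *)
  rewrite lee_fin; apply: (@le_trans _ _ (32 * eta / K * (2 * s + s + s / 2 + 2 * s))).
    have -> : beta * v = 32 * eta / K * (v / (2 * s)) by rewrite /beta; field; rewrite !gt_eqF.
    rewrite /alpha -mulrDr ler_wpM2l//.
    have : v / (2 * s) <= 2 * s by rewrite ler_pdivrMr ?mulr_gt0//; have -> : 2 * s * (2 * s) = 4 * s ^+ 2 by ring.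
    by lra.
  have -> : 192 * eta * s / K = 32 * eta / K * (6 * s) by field; rewrite gt_eqF.
  by rewrite ler_wpM2l//; lra.
move=> z0 {H}.
set q := Num.sqrt (nrm2 c).
set r := Num.sqrt (nrm2 z0).
have q0 : 0 <= q by exact: sqrtr_ge0.
have r0 : 0 <= r by exact: sqrtr_ge0.
pose t := eta * (2 * q + r + 1).
have t0 : 0 < t by rewrite mulr_gt0// ltr_wpDl// addr_ge0// mulr_ge0.
have mann : measurable_fun [set: R * R] (fun y => (\1_(@annulus R t) y)%:E : \bar R).
  by apply/measurable_EFinP/measurable_indic; exact: measurable_annulus.
apply: (@le_trans _ _ (\int[lam2]_y ((K^-1)%:E * (\1_(@annulus R t) y)%:E))%E).
  apply: ge0_le_integral => //.
  - by move=> y _; rewrite mule_ge0// lee_fin gpdf_ge0// ltW.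
  - apply: emeasurable_funM; last by apply/measurable_EFinP; exact: measurable_gpdf.
    apply: (measurableT_comp mf); apply: measurable_fun_pair => //.
    apply: measurable_cadd; last exact: measurable_cst.
    by apply: measurable_cmul => //; exact: measurable_cst.
  - exact: emeasurable_funM.
  - move=> y _; rewrite /f -!EFinM lee_fin !indicE.
    have [yE|yE] := boolP (_ \in E); last first.
      by rewrite mul0r mulr_ge0// invr_ge0 ltW.
    rewrite mul1r; move: yE; rewrite inE /E/= => /andP[y4 yann].
    have y2 : Num.sqrt (nrm2 y) <= 2.
      rewrite -(@ger0_norm _ (2 : R))// -sqrtr_sqr ler_sqrt//.
      by apply: le_trans y4 _; lra.
    have -> : y \in annulus t.
      rewrite inE /annulus/= y4/=; apply: le_trans yann _.
      rewrite /t ler_wpM2l ?(ltW eta0)// lerD2r.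
      apply: le_trans (sqrt_nrm2_cadd _ _) _; rewrite sqrt_nrm2_cmul lerD2r mulrC.
      by rewrite ler_wpM2r.
    rewrite mulr1 /gpdf; apply: (@le_trans _ _ (K^-1 * 1)); last by rewrite mulr1.
    apply: ler_pM => //.
    + by rewrite invr_ge0 mulr_ge0 ?pi_ge0// ltW.
    + rewrite lef_pV2 ?posrE ?mulr_gt0 ?pi_gt0// ler_peMl ?(ltW K0)//.
      by have := pi_ge2 R; apply: le_trans; lra.
    + by rewrite -expR0 ler_expR oppr_le0 divr_ge0 ?nrm2_ge0// ltW.
rewrite ge0_integralZl//; last by rewrite lee_fin invr_ge0 ltW.
rewrite integral_indic ?setIT//; last exact: measurable_annulus.
apply: (@le_trans _ _ ((K^-1)%:E * (32 * t)%:E)%E).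
  by rewrite lee_wpmul2l ?lee_fin ?invr_ge0 ?(ltW K0)//; exact: lam2_annulus_le.
rewrite -EFinM lee_fin.
have -> : K^-1 * (32 * t) = 32 * eta / K * (2 * q + r + 1) by rewrite /t; ring.
have -> : alpha + beta * nrm2 z0 = 32 * eta / K * (2 * q + 1 + s / 2 + r ^+ 2 / (2 * s)).
  by rewrite /alpha /beta -/q /r sqr_sqrtr ?nrm2_ge0//; field; rewrite !gt_eqF.
rewrite ler_wpM2l//.
(* AM-GM: [r <= s / 2 + r ^+ 2 / (2 * s)] *)
have : s / 2 + r ^+ 2 / (2 * s) - r = (s - r) ^+ 2 / (2 * s) by field; rewrite gt_eqF.
have : 0 <= (s - r) ^+ 2 / (2 * s) by rewrite divr_ge0 ?sqr_ge0// mulr_ge0// ltW.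
by lra.
Qed.

End gaussian_sums.

(** * Radial sums *)

Section radial_sums.
Variable R : realType.
Implicit Types (q r x : R) (n m : nat).

(** At [q = |z|^2] these are the variances of [p(z)] and [p'(z)]. The truncated exponent at [k = 0]
    is harmless, the factor [k^2] being zero. *)
Definition Ksum n q : R := \sum_(k < n.+1) q ^+ k.
Definition Vsum n q : R := \sum_(k < n.+1) k%:R ^+ 2 * q ^+ k.-1.

Lemma Ksum_ge1 n q : 0 <= q -> 1 <= Ksum n q.
Proof.
move=> q0; rewrite /Ksum big_ord_recl/= expr0 lerDl.
by apply: sumr_ge0 => i _; exact: exprn_ge0.
Qed.

Lemma Vsum_ge0 n q : 0 <= q -> 0 <= Vsum n q.
Proof. by move=> q0; apply: sumr_ge0 => i _; rewrite mulr_ge0 ?exprn_ge0. Qed.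

Lemma KsumS n q : Ksum n.+1 q = 1 + q * Ksum n q.
Proof.
rewrite /Ksum big_ord_recl/= expr0 mulr_sumr; congr (_ + _).
by apply: eq_bigr => i _; rewrite /bump/= add1n exprS.
Qed.

Lemma Ksum_recr n q : Ksum n.+1 q = Ksum n q + q ^+ n.+1.
Proof. by rewrite /Ksum big_ord_recr. Qed.

(* [\sum_j (j + 1) q ^ j] is the part of degree at most [n] in the square of
   the geometric sum. *)
Lemma sum_le_sqr_Ksum n q : 0 <= q ->
  \sum_(j < n.+1) j.+1%:R * q ^+ j <= Ksum n q ^+ 2.
Proof.
move=> q0; elim: n => [|n ih]; first by rewrite /Ksum !big_ord1 expr0 mulr1 expr1n.
have -> : \sum_(j < n.+2) j.+1%:R * q ^+ j =
    Ksum n.+1 q + q * \sum_(j < n.+1) j.+1%:R * q ^+ j.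
  rewrite /Ksum mulr_sumr big_ord_recl [X in _ = X + _]big_ord_recl/= -addrA -big_split/=.
  rewrite expr0 mulr1; congr (_ + _); apply: eq_bigr => i _.
  by rewrite /bump/= add1n exprS -[in LHS](addn1 i.+1) natrD; ring.
have K1 := Ksum_ge1 n q0.
apply: (@le_trans _ _ (Ksum n.+1 q + q * Ksum n q ^+ 2)).
  by rewrite lerD2l ler_wpM2l.
rewrite -subr_ge0 KsumS.
have -> : (1 + q * Ksum n q) ^+ 2 - (1 + q * Ksum n q + q * Ksum n q ^+ 2) =
  q * Ksum n q * (1 + q * Ksum n q - Ksum n q) by ring.
rewrite -KsumS Ksum_recr addrAC subrr add0r.
by rewrite !mulr_ge0 ?exprn_ge0//; lra.
Qed.

(** Summation by parts: multiplying by [1 - q] replaces [k^2] by the differences [2 j + 1], at most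
    [2 (j + 1)]. *)
Lemma Vsum_lt1 n q : 0 <= q -> (1 - q) * Vsum n q <= 2 * Ksum n q ^+ 2.
Proof.
move=> q0; apply: (@le_trans _ _ (2 * \sum_(j < n.+1) j.+1%:R * q ^+ j)); last first.
  by rewrite ler_wpM2l// sum_le_sqr_Ksum.
(* Keeping the boundary term [n^2 q^n] is what lets the induction telescope. *)
suff H : (1 - q) * Vsum n q + n%:R ^+ 2 * q ^+ n <= 2 * \sum_(j < n) j.+1%:R * q ^+ j.
  apply: (@le_trans _ _ ((1 - q) * Vsum n q + n%:R ^+ 2 * q ^+ n)).
    by rewrite lerDl mulr_ge0 ?exprn_ge0.
  apply: le_trans H _; rewrite ler_wpM2l// big_ord_recr/= lerDl.
  by rewrite mulr_ge0 ?exprn_ge0.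
elim: n => [|n ih].
  by rewrite /Vsum big_ord1 big_ord0 expr0n/= !mul0r !mulr0 addr0.
have -> : Vsum n.+1 q = Vsum n q + n.+1%:R ^+ 2 * q ^+ n by rewrite /Vsum big_ord_recr.
rewrite big_ord_recr/= [leRHS]mulrDr.
apply: (@le_trans _ _ ((1 - q) * Vsum n q + n%:R ^+ 2 * q ^+ n + 2 * (n.+1%:R * q ^+ n))); last first.
  by rewrite lerD2r.
rewrite -subr_ge0 (exprS q n) -(natr1 n).
set e := q ^+ n; have e0 : 0 <= e by exact: exprn_ge0.
have -> : (1 - q) * Vsum n q + n%:R ^+ 2 * e + 2 * ((n%:R + 1) * e) -
    ((1 - q) * (Vsum n q + (n%:R + 1) ^+ 2 * e) + (n%:R + 1) ^+ 2 * (q * e)) = e by ring.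
by [].
Qed.

Lemma Vsum_ge1 n q : 1 <= q -> Vsum n q <= n%:R ^+ 2 * Ksum n q.
Proof.
move=> q1; rewrite /Vsum /Ksum mulr_sumr; apply: ler_sum => -[k kn] _ /=.
have q0 : 0 <= q by apply: le_trans q1.
apply: ler_pM; rewrite ?exprn_ge0//.
  by rewrite ler_pXn2r ?nnegrE// ler_nat -ltnS.
by rewrite ler_weXn2l// leq_pred.
Qed.

(* AM-GM applied to the terms of index [k] and [n - k]. *)
Lemma Ksum_ge n r : 0 <= r -> n.+1%:R * r ^+ n <= Ksum n (r ^+ 2).
Proof.
move=> r0; have E : Ksum n (r ^+ 2) = \sum_(k < n.+1) (r ^+ 2) ^+ (n - k).
  rewrite /Ksum (reindex_inj rev_ord_inj)/=; apply: eq_bigr => k _.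
  by rewrite subSS.
suff : 2 * (n.+1%:R * r ^+ n) <= Ksum n (r ^+ 2) + Ksum n (r ^+ 2) by lra.
rewrite {2}E /Ksum -big_split/= (_ : 2 * _ = \sum_(k < n.+1) 2 * r ^+ n); last first.
  by rewrite sumr_const card_ord -mulr_natl; ring.
apply: ler_sum => -[k kn] _ /=.
have -> : r ^+ n = r ^+ k * r ^+ (n - k) by rewrite -exprD subnKC// -ltnS.
rewrite -!exprM mulnC [(2 * (n - k))%N]mulnC !exprM.
have := sqr_ge0 (r ^+ k - r ^+ (n - k)); lra.
Qed.

(** Up to a constant, the bound on the expected length per unit of area at modulus [r]. *)
Definition rho n r : R := (1 + Num.sqrt (Vsum n (r ^+ 2))) / Ksum n (r ^+ 2).

Lemma rho_ge0 n r : 0 <= rho n r.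
Proof.
rewrite divr_ge0 ?addr_ge0 ?sqrtr_ge0//.
by rewrite (le_trans _ (Ksum_ge1 _ _))// sqr_ge0.
Qed.

(** From [1 - r <= 1 - r ^+ 2] and [Vsum_lt1], [sqrt (1 - r) * sqrt V <= 2 * K]; the remaining 1 in
    the numerator is at most [K]. *)
Lemma rho_lt1 n r : 0 <= r -> r < 1 -> rho n r <= 3 / Num.sqrt (1 - r).
Proof.
move=> r0 r1; rewrite /rho; set q := r ^+ 2.
have q0 : 0 <= q by exact: sqr_ge0.
have K1 := Ksum_ge1 n q0; have K0 : 0 < Ksum n q by apply: lt_le_trans K1.
have V0 := Vsum_ge0 n q0.
have s0 : 0 < Num.sqrt (1 - r) by rewrite sqrtr_gt0 subr_gt0.
have s1 : Num.sqrt (1 - r) <= 1.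
  by rewrite -[leRHS]sqrtr1 ler_sqrt//; lra.
have H : Num.sqrt (1 - r) * Num.sqrt (Vsum n q) <= 2 * Ksum n q.
  rewrite -ler_sqr ?nnegrE ?mulr_ge0 ?sqrtr_ge0 ?(ltW K0)//.
  rewrite !exprMn !sqr_sqrtr//; last by lra.
  apply: (@le_trans _ _ ((1 - q) * Vsum n q)).
    by rewrite ler_wpM2r// /q; nra.
  by apply: le_trans (Vsum_lt1 n q0) _; rewrite ler_wpM2r ?sqr_ge0//; lra.
rewrite ler_pdivrMr// mulrAC ler_pdivlMr//.
by rewrite mulrDl mul1r [X in _ + X]mulrC; lra.
Qed.

(** Since [V <= n^2 K] and [K >= 1], [rho] is at most [(n + 1) / sqrt K], and [K >= (n + 1) r^n].
    The exponent [n / 2] is lowered to the integer [2 * N + 2], of which 2 will absorb the factor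
    [(1 + r)^2] of the cells. *)
Lemma rho_ge1 n N r : (4 * N + 4 <= n)%N -> 1 <= r ->
  rho n r <= Num.sqrt n.+1%:R / r ^+ (2 * N + 2).
Proof.
move=> nN r1; rewrite /rho; set q := r ^+ 2.
have r0 : 0 <= r by apply: le_trans r1.
have q1 : 1 <= q by rewrite /q expr_ge1.
have q0 : 0 <= q by apply: le_trans q1.
have K1 := Ksum_ge1 n q0; have K0 : 0 < Ksum n q by apply: lt_le_trans K1.
set k := Num.sqrt (Ksum n q).
have kk : k * k = Ksum n q by rewrite -expr2 sqr_sqrtr// ltW.
have k1 : 1 <= k by rewrite /k -[leLHS]sqrtr1 ler_sqrt// ltW.
have Vk : Num.sqrt (Vsum n q) <= n%:R * k.
  rewrite -[n%:R](@ger0_norm R)// -sqrtr_sqr -sqrtrM ?sqr_ge0// ler_sqrt.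
    exact: Vsum_ge1.
  by rewrite mulr_ge0 ?sqr_ge0// ltW.
set a := Num.sqrt n.+1%:R; set b := r ^+ (2 * N + 2).
have aa : a * a = n.+1%:R by rewrite -expr2 sqr_sqrtr.
have b0 : 0 < b by rewrite exprn_gt0//; apply: lt_le_trans r1.
have a0 : 0 < a by rewrite sqrtr_gt0.
have kab : a * b <= k.
  rewrite -[b](@ger0_norm R) ?(ltW b0)// -sqrtr_sqr -sqrtrM// ler_sqrt ?(ltW K0)//.
  apply: le_trans (Ksum_ge n r0); rewrite ler_wpM2l// /b -exprM ler_weXn2l//.
  by rewrite (leq_trans _ nN)// mulnDl mulnAC.
have h : n.+1%:R <= a / b * k.
  apply: (@le_trans _ _ (a / b * (a * b))).
    by rewrite -aa le_eqVlt; apply/orP; left; apply/eqP; field; rewrite gt_eqF.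
  by rewrite ler_wpM2l// divr_ge0// ltW.
rewrite ler_pdivrMr// -kk mulrA; apply: (@le_trans _ _ (n.+1%:R * k)).
  by rewrite -natr1 mulrDl mul1r addrC lerD.
by rewrite ler_wpM2r// (le_trans _ k1).
Qed.

Lemma invsqrt_sum m : \sum_(j < m) (Num.sqrt j.+1%:R)^-1 <= 2 * Num.sqrt (m%:R : R).
Proof.
elim: m => [|m ih]; first by rewrite big_ord0 sqrtr0 mulr0.
rewrite big_ord_recr/=; apply: le_trans (lerD ih (lexx _)) _.
set x := Num.sqrt m%:R; set y := Num.sqrt m.+1%:R.
have x0 : 0 <= x by exact: sqrtr_ge0.
have y0 : 0 < y by rewrite sqrtr_gt0.
have xx : x ^+ 2 = m%:R by rewrite sqr_sqrtr.
have yy : y ^+ 2 = m%:R + 1 by rewrite sqr_sqrtr// natr1.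
rewrite -lerBrDl -div1r ler_pdivrMr//.
have : 0 <= (y - x) ^+ 2 by exact: sqr_ge0.
by rewrite -mulrBr; nra.
Qed.

(** The square is there for summability: the inverse of the first power would sum to a logarithm. *)
Lemma Bernoulli_sqr N x : 0 <= x -> (1 + N%:R * x) ^+ 2 <= (1 + x) ^+ (2 * N).
Proof.
move=> x0; rewrite mulnC exprM ler_pXn2r ?nnegrE ?addr_ge0 ?mulr_ge0 ?exprn_ge0 ?addr_ge0//.
elim: N => [|N ih]; first by rewrite mul0r addr0 expr0.
rewrite exprS -natr1; apply: (@le_trans _ _ ((1 + x) * (1 + N%:R * x))).
  have h : 0 <= N%:R * x * x by rewrite !mulr_ge0.
  by rewrite -subr_ge0 (_ : _ - _ = N%:R * x * x)//; ring.
by rewrite ler_wpM2l// addr_ge0.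
Qed.

(** Comparison with the integral of [(1 + N x)^(-2)], whose primitive telescopes; the leading
    [1 / m] is the term at [l = 0]. *)
Lemma invsqr_sum N m L : (0 < N)%N -> (0 < m)%N ->
  \sum_(l < L) m%:R^-1 / (1 + N%:R * (l%:R / m%:R)) ^+ 2 <= m%:R^-1 + N%:R^-1 :> R.
Proof.
move=> N0 m0; have N1 : 0 < N%:R :> R by rewrite ltr0n.
have m1 : 0 < m%:R :> R by rewrite ltr0n.
case: L => [|L]; first by rewrite big_ord0 addr_ge0// invr_ge0 ltW.
rewrite big_ord_recl/= mul0r mulr0 addr0 expr1n divr1 lerD2l.
apply: (@le_trans _ _ (N%:R^-1 * (1 - (1 + N%:R * (L%:R / m%:R))^-1))); last first.
  by rewrite ler_piMr ?invr_ge0 ?(ltW N1)// gerBl invr_ge0 addr_ge0// mulr_ge0// divr_ge0.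
elim: L => [|L ih]; first by rewrite big_ord0 mul0r mulr0 addr0 invr1 subrr mulr0.
rewrite big_ord_recr/=; apply: le_trans (lerD ih (lexx _)) _.
rewrite /bump/= add1n.
set x := L%:R / m%:R; have -> : L.+1%:R / m%:R = x + m%:R^-1 by rewrite -natr1 mulrDl mul1r.
set y := m%:R^-1; set A := 1 + N%:R * x; set B := 1 + N%:R * (x + y).
have x0 : 0 <= x by rewrite divr_ge0.
have y0 : 0 < y by rewrite invr_gt0.
have A0 : 0 < A by rewrite /A ltr_pwDl// mulr_ge0.
have AB : B = A + N%:R * y by rewrite /A /B; ring.
have Ny : 0 < N%:R * y by rewrite mulr_gt0.
have B0 : 0 < B by lra.
rewrite -subr_ge0.
have -> : N%:R^-1 * (1 - B^-1) - (N%:R^-1 * (1 - A^-1) + y / B ^+ 2) =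
  y * (N%:R * y) / (A * B ^+ 2).
  by rewrite AB; field; rewrite !gt_eqF//= -AB.
by rewrite divr_ge0// ?mulr_ge0 ?exprn_ge0// ltW.
Qed.

(** As [1 - i / m = (m - i) / m], reversing the sum leaves inverse square roots of integers. The
    constant is 24 = 4 * 3 * 2, from [(1 + r)^2 <= 4], [rho_lt1] and [invsqrt_sum]. *)
Lemma rho_sum_lt1 n m : (0 < m)%N ->
  \sum_(i < m) m%:R^-1 * (1 + i%:R / m%:R) ^+ 2 * rho n (i%:R / m%:R) <= 24 :> R.
Proof.
move=> m0; have m1 : 0 < m%:R :> R by rewrite ltr0n.
set s := Num.sqrt (m%:R : R).
have s0 : 0 < s by rewrite sqrtr_gt0.
have ss : s * s = m%:R by rewrite -expr2 sqr_sqrtr// ltW.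
apply: (@le_trans _ _ (\sum_(i < m) 12 / s * (Num.sqrt (m - i)%:R)^-1)).
  apply: ler_sum => -[i im] _ /=; set r := i%:R / m%:R.
  have r0 : 0 <= r by rewrite divr_ge0.
  have r1 : r < 1 by rewrite ltr_pdivrMr// mul1r ltr_nat.
  have q0 : 0 < (m - i)%:R :> R by rewrite ltr0n subn_gt0.
  have E : Num.sqrt (1 - r) = Num.sqrt (m - i)%:R / s.
    have -> : 1 - r = (m - i)%:R / m%:R.
      by rewrite natrB ?(ltnW im)// mulrBl divff// gt_eqF.
    by rewrite sqrtrM ?sqrtrV// ltW.
  have t0 : 0 < Num.sqrt (m - i)%:R :> R by rewrite sqrtr_gt0.
  have h1 : (1 + r) ^+ 2 <= 4 by nra.
  apply: (@le_trans _ _ (m%:R^-1 * 4 * (3 / Num.sqrt (1 - r)))).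
    apply: ler_pM; last exact: rho_lt1.
    + by rewrite mulr_ge0 ?invr_ge0 ?sqr_ge0// ltW.
    + exact: rho_ge0.
    + by rewrite ler_wpM2l// invr_ge0 ltW.
  rewrite E -ss le_eqVlt; apply/orP; left; apply/eqP; field.
  by rewrite !gt_eqF.
rewrite -mulr_sumr (reindex_inj rev_ord_inj)/=.
rewrite (eq_bigr (fun j : 'I_m => (Num.sqrt j.+1%:R)^-1)); last first.
  by move=> [i im] _ /=; rewrite subKn.
apply: (@le_trans _ _ (12 / s * (2 * s))).
  by rewrite ler_wpM2l ?invsqrt_sum// divr_ge0// ltW.
by rewrite le_eqVlt; apply/orP; left; apply/eqP; field; rewrite gt_eqF.
Qed.

Lemma rho_sum_ge1 n N m L : (4 * N + 4 <= n)%N -> (0 < N)%N -> (0 < m)%N ->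
  \sum_(l < L) m%:R^-1 * (1 + (m + l)%:R / m%:R) ^+ 2 * rho n ((m + l)%:R / m%:R) <=
  4 * Num.sqrt n.+1%:R * (m%:R^-1 + N%:R^-1) :> R.
Proof.
move=> nN N0 m0; have m1 : 0 < m%:R :> R by rewrite ltr0n.
set a := Num.sqrt _; have a0 : 0 <= a by exact: sqrtr_ge0.
apply: (@le_trans _ _ (\sum_(l < L) 4 * a * (m%:R^-1 / (1 + N%:R * (l%:R / m%:R)) ^+ 2))).
  apply: ler_sum => l _; set r := (m + l)%:R / m%:R; set x : R := l%:R / m%:R.
  have x0 : 0 <= x by rewrite divr_ge0.
  have rE : r = 1 + x by rewrite /r natrD mulrDl divff// gt_eqF.
  have r1 : 1 <= r by rewrite rE lerDl.
  have r0 : 0 < r by lra.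
  apply: (@le_trans _ _ (m%:R^-1 * (4 * r ^+ 2) * (a / r ^+ (2 * N + 2)))).
    apply: ler_pM; last exact: rho_ge1.
    + by rewrite mulr_ge0 ?invr_ge0 ?sqr_ge0// ltW.
    + exact: rho_ge0.
    + by rewrite ler_wpM2l ?invr_ge0 ?(ltW m1)//; nra.
  have -> : m%:R^-1 * (4 * r ^+ 2) * (a / r ^+ (2 * N + 2)) = 4 * a * (m%:R^-1 / r ^+ (2 * N)).
    by rewrite exprD; field; rewrite !gt_eqF// exprn_gt0.
  rewrite ler_wpM2l ?mulr_ge0// ler_wpM2l ?invr_ge0 ?(ltW m1)//.
  rewrite lef_pV2 ?posrE ?exprn_gt0//; first by rewrite rE Bernoulli_sqr.
  by rewrite ltr_pwDl// mulr_ge0.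
by rewrite -mulr_sumr ler_wpM2l ?mulr_ge0// invsqr_sum.
Qed.

Lemma rho_sum_le n m M : (8 <= n)%N -> (n < m)%N -> (m <= M)%N ->
  \sum_(i < M) m%:R^-1 * (1 + i%:R / m%:R) ^+ 2 * rho n (i%:R / m%:R) <= 76 :> R.
Proof.
move=> n8 nm mM; have m0 : (0 < m)%N by case: m nm {mM}.
pose F i : R := m%:R^-1 * (1 + i%:R / m%:R) ^+ 2 * rho n (i%:R / m%:R).
rewrite -(big_mkord xpredT F) (big_cat_nat _ mM)//=.
rewrite [X in X + _]big_mkord.
have -> : \sum_(m <= i < M) F i = \sum_(l < M - m) F (m + l)%N.
  rewrite -{1}[m]add0n big_addn big_mkord.
  by apply: eq_bigr => i _; rewrite addnC.
pose N := (n %/ 4 - 1)%N.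
have h4 := divn_eq n 4; have h5 := ltn_pmod n (isT : 0 < 4)%N.
(* The hypothesis [8 <= n] makes [N] positive. With [n + 1 <= 12 N] and [n < m], the outer sum is at
   most 4 * (1 + 12) = 52. *)
have d2 : (2 <= n %/ 4)%N by rewrite leq_divRL.
have nN : (4 * N + 4 <= n)%N by rewrite /N; lia.
have N0 : (0 < N)%N by rewrite /N; lia.
have N12 : (n.+1 <= 12 * N)%N by rewrite /N; lia.
have -> : 76 = 24 + 52 :> R by lra.
apply: lerD; first exact: rho_sum_lt1.
apply: le_trans (rho_sum_ge1 _ nN N0 m0) _.
set a := Num.sqrt _; have a0 : 0 <= a by exact: sqrtr_ge0.
have aa : a * a = n.+1%:R by rewrite -expr2 sqr_sqrtr.
have n1 : 1 <= n.+1%:R :> R by rewrite ler1n.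
have an : a <= n.+1%:R by nra.
have h1 : a * m%:R^-1 <= 1.
  rewrite ler_pdivrMr ?ltr0n// mul1r; apply: le_trans an _; by rewrite ler_nat.
have h2 : a * N%:R^-1 <= 12.
  rewrite ler_pdivrMr ?ltr0n//; apply: le_trans an _.
  by rewrite -(natrM _ 12) ler_nat.
by rewrite mulrDr -!mulrA; lra.
Qed.

End radial_sums.

(** * Covering a lemniscate by polar cells *)

Section complex_polynomials.
Variable R : realType.
Local Notation C := R[i].
Local Notation normc := (@Normc.normc R).
Implicit Types (p : {poly C}) (z w : C).

Lemma normc_ge0 z : 0 <= normc z.
Proof. by case: z => a b; exact: sqrtr_ge0. Qed.

Lemma sqrt_nrm2_coords z : Num.sqrt (nrm2 (coords z)) = normc z.
Proof. by case: z. Qed.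

Lemma normc_le_ReIm (a b : R) : normc (Complex a b) <= `|a| + `|b|.
Proof.
rewrite /= -ler_sqr ?nnegrE ?sqrtr_ge0 ?addr_ge0// sqr_sqrtr ?addr_ge0 ?sqr_ge0//.
rewrite -(real_normK (num_real a)) -(real_normK (num_real b)).
have := normr_ge0 a; have := normr_ge0 b; nra.
Qed.

Lemma le_normcB z w : normc (z - w) <= normc z + normc w.
Proof. by rewrite -[normc w]normcN; exact: le_normcD. Qed.

Lemma lemniscateE p z : lemniscate p z <-> normc p.[z] = 1.
Proof.
rewrite /lemniscate/= normc_def; case: (p.[z]) => a b /=; split => [[]//|->].
by [].
Qed.

Lemma horner_bounded p (M : R) : exists B : R, 0 <= B /\
  forall z, normc z <= M -> normc p.[z] <= B.
Proof.
elim/poly_ind: p => [|q c [B [B0 hB]]].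
  by exists 0; split => // z _; rewrite horner0 Normc.normc0.
exists (B * `|M| + normc c); split.
  by rewrite addr_ge0 ?mulr_ge0// normc_ge0.
move=> z zM; rewrite hornerMXaddC; apply: le_trans (le_normcD _ _) _.
rewrite lerD2r Normc.normcM ler_pM ?normc_ge0 ?hB//.
exact: le_trans zM (ler_norm _).
Qed.

(** Horner induction on [p]. The constant depends on the polynomial, so every mesh threshold derived
    from it is pathwise. *)
Lemma horner_taylor p (M : R) : exists B : R, 0 <= B /\
  forall z w, normc z <= M -> normc w <= M ->
  normc (p.[z] - p.[w] - p^`().[w] * (z - w)) <= B * normc (z - w) ^+ 2.
Proof.
elim/poly_ind: p => [|q c [B [B0 hB]]].
  exists 0; split => // z w _ _.
  by rewrite deriv0 !horner0 mul0r !subr0 Normc.normc0 mul0r.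
have [B' [B'0 hB']] := horner_bounded q^`() M.
exists (`|M| * B + B'); split; first by rewrite addr_ge0// mulr_ge0.
move=> z w zM wM.
rewrite derivD derivM derivX derivC addr0 mulr1 !hornerMXaddC.
rewrite hornerD hornerMX.
have -> : q.[z] * z + c - (q.[w] * w + c) - (q^`().[w] * w + q.[w]) * (z - w) =
  z * (q.[z] - q.[w] - q^`().[w] * (z - w)) + q^`().[w] * (z - w) * (z - w) by ring.
apply: le_trans (le_normcD _ _) _; rewrite !Normc.normcM mulrDl; apply: lerD.
  rewrite -mulrA ler_pM ?normc_ge0//; last exact: hB.
  exact: le_trans zM (ler_norm _).
rewrite -mulrA -expr2 ler_wpM2r ?sqr_ge0//; exact: hB'.
Qed.

Lemma horner_coercive p (L : R) : (1 < size p)%N ->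
  exists M : R, forall z, M < normc z -> L < normc p.[z].
Proof.
elim/poly_ind: p L => [|q c ih] L; first by rewrite size_poly0.
have [->|q0] := eqVneq q 0.
  by rewrite mul0r add0r size_polyC; case: (c != 0).
rewrite size_MXaddC (negbTE q0)/= ltnS => sq.
have := sq; rewrite leq_eqVlt => /orP[/eqP/esym/eqP/size_poly1P[a a0 qa]|sq1].
  have na : 0 < normc a.
    by rewrite lt_neqAle normc_ge0 andbT eq_sym; apply: contra a0 => /eqP /Normc.eq0_normc ->.
  exists ((L + normc c) / normc a) => z; rewrite ltr_pdivrMr// => hz.
  rewrite qa hornerMXaddC hornerC.
  have : normc (a * z) <= normc (a * z + c) + normc c.
    by rewrite -{1}[a * z](addrK c); exact: le_normcB.
  by rewrite Normc.normcM [normc a * _]mulrC; lra.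
have [M hM] := ih (`|L| + normc c) sq1.
exists (Num.max M 1) => z; rewrite gt_max => /andP[/hM h1 z1].
rewrite hornerMXaddC.
have : normc (q.[z] * z) <= normc (q.[z] * z + c) + normc c.
  by rewrite -{1}[q.[z] * z](addrK c); exact: le_normcB.
rewrite Normc.normcM => h2.
have h3 : normc q.[z] <= normc q.[z] * normc z by rewrite ler_peMr ?normc_ge0// ltW.
have := ler_norm L; lra.
Qed.

Lemma lemniscate_bounded p : (1 < size p)%N ->
  exists M : R, forall z, lemniscate p z -> normc z <= M.
Proof.
move=> /(horner_coercive 1)[M hM]; exists M => z /lemniscateE z1.
by rewrite leNgt; apply/negP => /hM; rewrite z1 ltxx.
Qed.

End complex_polynomials.

(** * The polar grid *)

Section polar_grid.
Variable R : realType.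
Local Notation C := R[i].
Local Notation normc := (@Normc.normc R).
Implicit Types (a b t : R) (z : C).

Lemma cos_lipschitz a b : `|cos a - cos b| <= `|a - b|.
Proof.
wlog ab : a b / a <= b.
  by move=> H; have [/H//|/ltW/H] := leP a b; rewrite distrC [leRHS]distrC.
have [c _ E] : exists2 c, c \in `[a, b] & cos b - cos a = - sin c * (b - a).
  apply: (@MVT_segment R cos (fun x => - sin x)) => //.
  by apply: continuous_subspaceT => x; exact: continuous_cos.
by rewrite distrC E [leRHS]distrC normrM normrN ler_piMl// sin_max.
Qed.

Lemma sin_lipschitz a b : `|sin a - sin b| <= `|a - b|.
Proof. by rewrite -!cosBpihalf (le_trans (cos_lipschitz _ _))// opprB addrA subrK. Qed.

Lemma pi_le4 : pi <= 4 :> R.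
Proof. by have [/andP[_ h] _] := pihalf_02_cos_pihalf R; lra. Qed.

(** A radius below [m], an angle in [[0, 4]], which contains [[0, pi]], and the sign of the
    imaginary part, all with step [1 / m]. Each radius carries [2 (4 m + 1)] cells, so the width
    grows with the radius. *)
Definition cell m : finType := ('I_(m * m) * 'I_(4 * m).+1 * bool)%type.
Definition crad m (c : cell m) : R := c.1.1%:R / m%:R.
Definition cwidth m (c : cell m) : R := 2 * (1 + crad c) / m%:R.
Definition ccenter m (c : cell m) : C :=
  Complex (crad c * cos (c.1.2%:R / m%:R))
          (crad c * ((-1) ^+ c.2 * sin (c.1.2%:R / m%:R))).

Lemma crad_ge0 m (c : cell m) : 0 <= crad c.
Proof. by rewrite divr_ge0. Qed.

Lemma normc_ccenter m (c : cell m) : normc (ccenter c) = crad c.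
Proof.
rewrite /ccenter; have := crad_ge0 c; move: (crad c) (c.1.2%:R / _) (c.2) => r t b r0 /=.
by rewrite !exprMn sqrr_sign mul1r -mulrDr cos2Dsin2 mulr1 sqrtr_sqr ger0_norm.
Qed.

Lemma polar_unit a b : a ^+ 2 + b ^+ 2 = 1 ->
  exists t (s : bool), [/\ 0 <= t, t <= pi, a = cos t & b = (-1) ^+ s * sin t].
Proof.
move=> ab; have a1 : -1 <= a <= 1.
  by rewrite -ler_norml -ler_sqr ?nnegrE// real_normK ?num_real// expr1n; have := sqr_ge0 b; lra.
exists (acos a), (b < 0); split; [exact: acos_ge0|exact: acos_lepi| |].
  by rewrite acosK// in_itv.
rewrite sin_acos// (_ : 1 - a ^+ 2 = b ^+ 2); last by rewrite -ab addrC addKr.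
rewrite sqrtr_sqr; have [b0|b0] := ltP b 0; first by rewrite ltr0_norm// expr1 mulN1r opprK.
by rewrite ger0_norm// expr0 mul1r.
Qed.

Lemma natr_floor m t : (0 < m)%N -> 0 <= t ->
  exists k : nat, k%:R / m%:R <= t < k%:R / m%:R + m%:R^-1.
Proof.
move=> m0 t0; have m1 : 0 < m%:R :> R by rewrite ltr0n.
exists (Num.truncn (t * m%:R)).
have /andP[h1 h2] : (Num.truncn (t * m%:R))%:R <= t * m%:R < (Num.truncn (t * m%:R)).+1%:R.
  by apply: truncn_itv; rewrite mulr_ge0// ltW.
rewrite ler_pdivrMr// h1/= -[X in _ + X]mul1r -mulrDl ltr_pdivlMr//.
by rewrite natr1.
Qed.

(** Rounding the radius down keeps the centre in every disc about 0 that contains [z], where the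
    Taylor bound is valid. *)
Lemma polar_cell m z : (0 < m)%N -> normc z < m%:R ->
  exists c : cell m, crad c <= normc z /\ normc (z - ccenter c) <= cwidth c.
Proof.
move=> m0 zm; have m1 : 0 < m%:R :> R by rewrite ltr0n.
have [i /andP[i1 i2]] := natr_floor m0 (normc_ge0 z).
have im : (i < m * m)%N.
  by rewrite -(ltr_nat R) natrM -ltr_pdivrMr//; exact: le_lt_trans zm.
have [t [s [t0 tpi zt]]] : exists t (s : bool), [/\ 0 <= t, t <= pi &
    z = Complex (normc z * cos t) (normc z * ((-1) ^+ s * sin t))].
  have [z0|z0] := eqVneq (normc z) 0.
    exists 0, false; split; [by []|exact: pi_ge0|].
    by rewrite z0 !mul0r; exact: Normc.eq0_normc.
  have zp : 0 < normc z by rewrite lt_neqAle eq_sym z0 normc_ge0.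
  case: z z0 zp {zm i1 i2} => a b z0 zp; set r := normc _ in z0 zp *.
  have rr : r ^+ 2 = a ^+ 2 + b ^+ 2 by rewrite /r/= sqr_sqrtr// addr_ge0 ?sqr_ge0.
  have [|t [s [t0 tp ha hb]]] := @polar_unit (a / r) (b / r).
    by rewrite !expr_div_n -mulrDl -rr divff// expf_neq0.
  by exists t, s; split => //; rewrite -ha -hb ![r * _]mulrC !divfK.
have [j /andP[j1 j2]] := natr_floor m0 t0.
have jm : (j < (4 * m).+1)%N.
  rewrite ltnS -(ler_nat R) natrM -ler_pdivrMr//.
  by apply: le_trans j1 _; apply: le_trans tpi _; exact: pi_le4.
exists (Ordinal im, Ordinal jm, s); split => //.
have -> : z - ccenter (Ordinal im, Ordinal jm, s) = Complex
    (normc z * cos t - i%:R / m%:R * cos (j%:R / m%:R))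
    (normc z * ((-1) ^+ s * sin t) - i%:R / m%:R * ((-1) ^+ s * sin (j%:R / m%:R))).
  by rewrite {1}zt.
rewrite /cwidth /crad/=.
have r0 : 0 <= i%:R / m%:R :> R by rewrite divr_ge0.
apply: le_trans (normc_le_ReIm _ _) _.
move: (i%:R / m%:R) (j%:R / m%:R) (normc z) r0 i1 i2 j1 j2 => r th q r0 i1 i2 j1 j2.
have mi0 : 0 < m%:R^-1 :> R by rewrite invr_gt0.
have dt : `|t - th| <= m%:R^-1 by rewrite ger0_norm; lra.
have dq : `|q - r| <= m%:R^-1 by rewrite ger0_norm; lra.
have key (f : R) (g : R) : `|f| <= 1 -> `|f - g| <= m%:R^-1 ->
    `|q * f - r * g| <= (1 + r) / m%:R.
  move=> f1 fg; have -> : q * f - r * g = (q - r) * f + r * (f - g) by ring.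
  apply: le_trans (ler_normD _ _) _; rewrite !normrM mulrDl mul1r; apply: lerD.
    by rewrite -[leRHS]mulr1 ler_pM.
  by rewrite (ger0_norm r0) ler_wpM2l.
have -> : 2 * (1 + r) / m%:R = (1 + r) / m%:R + (1 + r) / m%:R by field; rewrite gt_eqF.
apply: lerD; apply: key.
- exact: cos_max.
- by apply: le_trans (cos_lipschitz _ _) dt.
- by rewrite normrM normrX normrN1 expr1n mul1r sin_max.
- rewrite -mulrBr normrM normrX normrN1 expr1n mul1r.
  by apply: le_trans (sin_lipschitz _ _) dt.
Qed.

End polar_grid.

(** * Covers of the lemniscate by cells *)

Section covering.
Variable R : realType.
Local Notation C := R[i].
Local Notation normc := (@Normc.normc R).
Implicit Types (p : {poly C}) (z w : C).

Lemma cdiam_ge0 (U : set C) : (0 <= cdiam U)%E.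
Proof. by rewrite /cdiam le_max lexx. Qed.

Lemma cdiam_le (U : set C) (r : R) : 0 <= r ->
  (forall z w, U z -> U w -> normc (z - w) <= r) -> (cdiam U <= r%:E)%E.
Proof.
move=> r0 h; rewrite /cdiam ge_max lee_fin r0/=; apply: ge_ereal_sup => _ /= [z Uz [w Uw <-]].
by rewrite lee_fin h.
Qed.

Lemma cdiam_ub (U : set C) z w : U z -> U w -> ((normc (z - w))%:E <= cdiam U)%E.
Proof.
move=> Uz Uw; rewrite /cdiam le_max; apply/orP; right.
by apply: ereal_sup_ubound; exists z => //; exists w.
Qed.

Lemma cdiam_set0 : cdiam (set0 : set C) = 0%E.
Proof.
apply/eqP; rewrite eq_le cdiam_ge0 andbT.
by apply: cdiam_le => // z w [].
Qed.

(** A finite cover is continued by empty sets, whose diameter is 0 by convention. *)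
Lemma hausdorff1_pre_le_seq (delta : R) (A : set C) (s : seq (set C)) : 0 <= delta ->
  (forall i, (cdiam (nth set0 s i) <= delta%:E)%E) ->
  A `<=` \bigcup_i nth set0 s i ->
  (hausdorff1_pre delta A <= \sum_(V <- s) cdiam V)%E.
Proof.
move=> d0 hd hA; apply: ereal_inf_lbound; exists (nth set0 s) => //=.
rewrite (nneseries_split 0 (size s)); last by move=> k _; exact: cdiam_ge0.
rewrite [X in (_ + X)%E]eseries0 ?adde0; last first.
  by move=> k /= sk _; rewrite nth_default ?cdiam_set0// -(add0n (size s)).
by rewrite add0n [RHS](big_nth set0).
Qed.

(** Tested at one point only, in the form of the event of [gsum_annulus_bound]. *)
Definition hit p z (eta : R) : bool :=
  (nrm2 (coords p.[z]) <= 4) &&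
  (`|Num.sqrt (nrm2 (coords p.[z])) - 1| <= eta * (Num.sqrt (nrm2 (coords p^`().[z])) + 1)).

Definition gridsum m p : R :=
  \sum_(c : cell m) 2 * cwidth R c * (hit p (ccenter R c) (cwidth R c))%:R.

(** The threshold makes [e * (B1 + B2 + 1) <= 1]. The Taylor remainder [B2 * e ^+ 2] is then at most
    [e], whence the [+ 1] beside [|p'|], and [e * (|p'| + 1) <= 1] gives [|p| <= 2] at the
    centre. *)
Lemma lemniscate_hit p (M : R) : 0 <= M -> exists m0 : nat, forall m, (m0 <= m)%N ->
  forall z (c : cell m), lemniscate p z -> normc z <= M -> crad R c <= normc z ->
  normc (z - ccenter R c) <= cwidth R c -> hit p (ccenter R c) (cwidth R c).
Proof.
move=> M0.
have [B1 [B10 h1]] := horner_bounded p^`() M.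
have [B2 [B20 h2]] := horner_taylor p M.
set D := 2 * (1 + M) * (B1 + B2 + 1).
have D0 : 0 <= D by rewrite !mulr_ge0// ?addr_ge0.
exists (Num.truncn D).+1 => m hm z c /lemniscateE pz zM cz zc.
have mD : D < m%:R.
  apply: lt_le_trans (truncnS_gt D) _; by rewrite ler_nat.
have m0 : 0 < m%:R :> R by apply: le_lt_trans mD.
have cM : normc (ccenter R c) <= M by rewrite normc_ccenter; exact: le_trans zM.
have e0 : 0 <= cwidth R c by rewrite divr_ge0// mulr_ge0// addr_ge0// crad_ge0.
have eB : cwidth R c * (B1 + B2 + 1) <= 1.
  rewrite /cwidth mulrAC ler_pdivrMr// mul1r; apply: le_trans (ltW mD).
  rewrite /D ler_wpM2r ?addr_ge0// ler_wpM2l// lerD2l.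
  exact: le_trans zM.
have := h2 z (ccenter R c) zM cM; have := h1 _ cM; move: zc.
rewrite /hit sqrt_nrm2_coords sqrt_nrm2_coords.
have -> : (nrm2 (coords p.[ccenter R c]) <= 4) = (normc p.[ccenter R c] <= 2).
  rewrite -sqrt_nrm2_coords -[RHS]ler_sqr ?nnegrE ?sqrtr_ge0// sqr_sqrtr ?nrm2_ge0//.
  by congr (_ <= _); ring.
set w := ccenter R c; set e := cwidth R c in e0 eB *.
set a := normc p.[w]; set b := normc p^`().[w] => zw bB hT.
have b0 : 0 <= b by exact: normc_ge0.
have n0 : 0 <= normc (z - w) by exact: normc_ge0.
have h : normc (p.[z] - p.[w]) <= e * (b + 1).
  have -> : p.[z] - p.[w] = (p.[z] - p.[w] - p^`().[w] * (z - w)) + p^`().[w] * (z - w) by ring.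
  apply: le_trans (le_normcD _ _) _; rewrite Normc.normcM -/b.
  have t1 : b * normc (z - w) <= b * e by rewrite ler_wpM2l.
  have t2 : B2 * normc (z - w) ^+ 2 <= B2 * e * e.
    by rewrite -mulrA -expr2 ler_wpM2l// ler_pXn2r ?nnegrE.
  have t3 : B2 * e * e <= 1 * e by rewrite ler_wpM2r//; nra.
  by lra.
have h' : `|a - 1| <= normc (p.[z] - p.[w]).
  rewrite ler_norml; apply/andP; split.
    have : normc p.[z] <= normc (p.[z] - p.[w]) + a by rewrite -{1}(subrK p.[w] p.[z]) le_normcD.
    by rewrite pz; lra.
  have : a <= normc (p.[z] - p.[w]) + normc p.[z].
    rewrite /a -[X in normc X <= _](subKr p.[z]) [leRHS]addrC; exact: le_normcB.
  by rewrite pz; lra.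
apply/andP; split; last exact: le_trans h' h.
have e1 : e * (b + 1) <= 1 by nra.
by have := ler_norm (a - 1); lra.
Qed.

Lemma hausdorff1_pre_le_gridsum p (delta : R) : (1 < size p)%N -> 0 < delta ->
  exists m0 : nat, forall m, (m0 <= m)%N ->
  (hausdorff1_pre delta (lemniscate p) <= (gridsum m p)%:E)%E.
Proof.
move=> /lemniscate_bounded[M' hM'] d0.
set M := `|M'|; have M0 : 0 <= M by exact: normr_ge0.
have hM z : lemniscate p z -> normc z <= M by move=> /hM'/le_trans; apply; exact: ler_norm.
have [m1 h1] := lemniscate_hit p M0.
set D := 4 * (1 + M) / delta.
have D0 : 0 <= D by rewrite divr_ge0 ?(ltW d0)// mulr_ge0// addr_ge0.
(* Three demands on the mesh: cells that meet the lemniscate are hit, their diameters are at most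
   [delta], and the grid contains the lemniscate. *)
exists (maxn m1 (maxn (Num.truncn D).+1 (Num.truncn M).+1)) => m.
rewrite !geq_max => /andP[mm1 /andP[mD mM]].
have Dm : D < m%:R by apply: lt_le_trans (truncnS_gt D) _; rewrite ler_nat.
have Mm : M < m%:R by apply: lt_le_trans (truncnS_gt M) _; rewrite ler_nat.
have m0 : 0 < m%:R :> R by apply: le_lt_trans Mm.
have m0' : (0 < m)%N by rewrite -(ltr_nat R).
have e0 (c : cell m) : 0 <= cwidth R c by rewrite divr_ge0// mulr_ge0// addr_ge0// crad_ge0.
pose U (c : cell m) : set C := [set z | [/\ lemniscate p z, crad R c <= normc z &
  normc (z - ccenter R c) <= cwidth R c]].
have dU c : (cdiam (U c) <= (2 * cwidth R c)%:E)%E.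
  apply: cdiam_le => [|z w [_ _ zc] [_ _ wc]]; first by rewrite mulr_ge0.
  have -> : z - w = (z - ccenter R c) - (w - ccenter R c) by ring.
  by apply: le_trans (le_normcB _ _) _; lra.
(* Cells far from the origin are wide, but there [U c] is empty; a point of [U c] gives
   [crad c <= M]. *)
have dU' c : (cdiam (U c) <= delta%:E)%E.
  have [->|/set0P[z [Lz cz zc]]] := eqVneq (U c) set0.
    by rewrite cdiam_set0 lee_fin ltW.
  apply: le_trans (dU c) _; rewrite lee_fin /cwidth mulrA ler_pdivrMr//.
  move: Dm; rewrite /D ltr_pdivrMr// => /ltW; rewrite [m%:R * _]mulrC; apply: le_trans.
  have := le_trans cz (hM _ Lz); lra.
have nthU i : nth set0 [seq U c | c <- enum {: cell m}] i = set0 \/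
    exists c, nth set0 [seq U c | c <- enum {: cell m}] i = U c.
  have [h|h] := ltnP i (size (enum {: cell m})).
    have [c0 _] : exists c0 : cell m, true by case: (enum _) h => // c0 s _; exists c0.
    by right; exists (nth c0 (enum {: cell m}) i); rewrite (nth_map c0).
  by left; rewrite nth_default// size_map.
apply: (@le_trans _ _ (\sum_(V <- [seq U c | c <- enum {: cell m}]) cdiam V)%E).
  apply: hausdorff1_pre_le_seq; first exact: ltW.
    by move=> i; have [->|[c ->]] := nthU i; rewrite ?dU'// cdiam_set0 lee_fin ltW.
  move=> z Lz; have [|c [c1 c2]] := @polar_cell R m z m0'.
    by apply: le_lt_trans Mm; exact: hM.
  exists (index c (enum {: cell m})) => //.
  by rewrite (nth_map c) ?nth_index ?index_mem ?mem_enum.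
rewrite big_map big_enum/= /gridsum -sumEFin; apply: lee_sum => c _.
have [Uc|/set0P[z [Lz cz zc]]] := eqVneq (U c) set0.
  by rewrite Uc cdiam_set0 lee_fin; apply: mulr_ge0 => //; apply: mulr_ge0 (e0 c).
by rewrite (h1 m mm1 z c Lz (hM _ Lz) cz zc) mulr1.
Qed.

End covering.

(** * Expected length *)

Lemma indic_setb (R : realType) (T : Type) (f : T -> bool) t :
  \1_[set x | f x] t = (f t)%:R :> R.
Proof.
rewrite indicE; have [ft|ft] := boolP (f t); first by rewrite mem_set.
by rewrite memNset//=; exact/negP.
Qed.

Lemma set_pair1 (S U : Type) (x : S) (y : U) : [set (x, y)] = [set x] `*` [set y].
Proof. by apply/seteqP; split => -[z w] /= [-> ->]. Qed.

Section random_polynomial.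
Context (R : realType) (d : measure_display) (T : measurableType d).
Variables (P : probability T R) (n : nat) (a : 'I_n.+1 -> T -> R[i]).
Hypothesis a_iid : iid_std_cgauss P a.
Local Notation C := R[i].
Local Notation normc := (@Normc.normc R).
Local Notation lam2 := (@lam2 R).
Implicit Types (z : C).

Let A k : T -> R * R := @coords R \o a k.

Let mA k : measurable_fun [set: T] (A k).
Proof. by have [/(_ k)[]] := a_iid. Qed.

Lemma cgauss_pdf_gpdf (y : R * R) : cgauss_pdf (Complex y.1 y.2) = gpdf 1 y.
Proof.
by rewrite /cgauss_pdf /gpdf /= sqr_sqrtr ?mulr1 ?divr1// addr_ge0 ?sqr_ge0.
Qed.

Let lawA k (B : set (R * R)) : measurable B ->
  (P (A k @^-1` B) = \int[lam2]_(y in B) (gpdf 1 y)%:E)%E.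
Proof.
move=> mB; have [/(_ k)[_ h] _] := a_iid; rewrite h//.
by apply: eq_integral => y _; rewrite cgauss_pdf_gpdf.
Qed.

Let indA (J : {set 'I_n.+1}) (B : 'I_n.+1 -> set (R * R)) :
  (forall j, measurable (B j)) ->
  (P (\bigcap_(j in [set` J]) (A j @^-1` B j)) = \prod_(j in J) P (A j @^-1` B j))%E.
Proof. by move=> mB; have [_] := a_iid; exact. Qed.

Definition vpow z k : R * R := coords (z ^+ k).
Definition dpow z k : R * R := coords (z ^+ k.-1 *+ k).

Lemma coordsD (x y : C) : coords (x + y) = cadd (coords x) (coords y).
Proof. by case: x y => [x1 x2] [y1 y2]. Qed.

Lemma coordsM (x y : C) : coords (x * y) = cmul (coords x) (coords y).
Proof. by case: x y => [x1 x2] [y1 y2]. Qed.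

Lemma coords_gsum z t : (coords (random_poly a t).[z], coords (random_poly a t)^`().[z]) =
  gsum A (vpow z) (dpow z) n.+1 t.
Proof.
suff H m : (m <= n.+1)%N ->
  (coords (\sum_(k < m) a (inord k) t *: 'X^k).[z],
   coords (\sum_(k < m) a (inord k) t *: 'X^k)^`().[z]) = gsum A (vpow z) (dpow z) m t.
  rewrite -H// /random_poly; congr (coords _, coords _).
    by congr (_.[z]); apply: eq_bigr => k _; rewrite inord_val.
  by congr (_^`().[z]); apply: eq_bigr => k _; rewrite inord_val.
elim: m => [_|m ih mn]; first by rewrite big_ord0 deriv0 horner0.
rewrite /= -ih ?(ltnW mn)//= big_ord_recr/= derivD !hornerD !coordsD.
rewrite derivZ derivXn !hornerZ hornerXn hornerMn hornerXn !coordsM.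
by [].
Qed.

Lemma nrm2_coords z : nrm2 (coords z) = normc z ^+ 2.
Proof. by case: z => x y; rewrite /= sqr_sqrtr// addr_ge0 ?sqr_ge0. Qed.

Lemma normcX z k : normc (z ^+ k) = normc z ^+ k.
Proof.
elim: k => [|k ih]; first by rewrite !expr0 Normc.normc1.
by rewrite !exprS Normc.normcM ih.
Qed.

Lemma sum_nrm2_vpow z : \sum_(k < n.+1) nrm2 (vpow z k) = Ksum n (normc z ^+ 2).
Proof. by apply: eq_bigr => k _; rewrite nrm2_coords normcX exprAC. Qed.

Lemma sum_nrm2_dpow z : \sum_(k < n.+1) nrm2 (dpow z k) = Vsum n (normc z ^+ 2).
Proof.
apply: eq_bigr => k _; rewrite nrm2_coords normcMn normcX -[normc z ^+ _ *+ k]mulr_natl exprMn.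
by rewrite [normc z ^+ _ ^+ 2]exprAC.
Qed.

Lemma measurable_coords_horner z :
  measurable_fun [set: T] (fun t => coords (random_poly a t).[z]).
Proof.
have -> : (fun t => coords (random_poly a t).[z]) =
    (fun t => (gsum A (vpow z) (dpow z) n.+1 t).1).
  by apply/funext => t; rewrite -coords_gsum.
apply: (measurableT_comp measurable_fst); exact: measurable_gsum.
Qed.

Lemma measurable_hit z eta : measurable [set t | hit (random_poly a t) z eta].
Proof.
have -> : [set t | hit (random_poly a t) z eta] =
  [set t | (nrm2 (gsum A (vpow z) (dpow z) n.+1 t).1 <= 4)%R &&
     (`|Num.sqrt (nrm2 (gsum A (vpow z) (dpow z) n.+1 t).1) - 1|%R <=
        eta * (Num.sqrt (nrm2 (gsum A (vpow z) (dpow z) n.+1 t).2) + 1))%R].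
  by congr mkset; apply/funext => t; rewrite -coords_gsum.
have mg := measurable_gsum mA (vpow z) (dpow z) n.+1.
have m1 := measurableT_comp measurable_fst mg.
have m2 := measurableT_comp measurable_snd mg.
apply: measurable_setb; apply: measurable_and.
  by apply: measurable_fun_ler => //; exact: (measurableT_comp (@measurable_nrm2 R) m1).
apply: measurable_fun_ler.
  apply: measurableT_comp => //; apply: measurable_funB => //.
  exact: (measurableT_comp (@measurable_sqrt_nrm2 R) m1).
apply: measurable_funM => //; apply: measurable_funD => //.
exact: (measurableT_comp (@measurable_sqrt_nrm2 R) m2).
Qed.

Lemma prob_hit z eta : 0 < eta ->
  (P [set t | hit (random_poly a t) z eta] <= (192 * eta * rho n (normc z))%:E)%E.
Proof.
move=> eta0.
have u0 : vpow z 0 = (1, 0) by rewrite /vpow expr0.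
have w0 : dpow z 0 = (0, 0) by rewrite /dpow mulr0n.
have := gsum_annulus_bound mA lawA indA u0 w0 eta0.
rewrite sum_nrm2_vpow sum_nrm2_dpow -mulrA -/(rho n (normc z)); apply: le_trans.
rewrite le_eqVlt; apply/orP; left; apply/eqP; congr (P _).
by congr mkset; apply/funext => t; rewrite -coords_gsum.
Qed.

(** Diameter times probability is [2 eta * 192 eta rho] with [eta = 2 (1 + r) / m], and 1536 = 2 *
    192 * 4. The number of cells per radius divided by [m] is at most 10, and 76 bounds the radial
    sum. *)
Lemma expectation_gridsum m : (8 <= n)%N -> (n < m)%N ->
  (\int[P]_t (gridsum m (random_poly a t))%:E <= (1536 * 10 * 76)%:E)%E.
Proof.
move=> n8 nm; have m0 : (0 < m)%N by case: m nm.
have m1 : 0 < m%:R :> R by rewrite ltr0n.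
have e0 (c : cell m) : 0 < cwidth R c by rewrite divr_gt0// mulr_gt0// ltr_pwDl// crad_ge0.
pose H (c : cell m) : set T := [set t | hit (random_poly a t) (ccenter R c) (cwidth R c)].
have mH (c : cell m) : measurable (H c) by exact: measurable_hit.
rewrite (eq_integral (fun t => \sum_(c : cell m) (2 * cwidth R c)%:E * (\1_(H c) t)%:E)%E); last first.
  move=> t _; rewrite /gridsum -sumEFin; apply: eq_bigr => c _.
  by rewrite EFinM /H indic_setb.
have mi (c : cell m) : measurable_fun [set: T] (fun t => (\1_(H c) t)%:E : \bar R).
  by apply/measurable_EFinP; exact: measurable_indic.
rewrite ge0_integral_sum//; last 2 first.
  - by move=> c; exact: emeasurable_funM.
  - by move=> c t _; rewrite mule_ge0// lee_fin mulr_ge0// ltW.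
pose F i : R := m%:R^-1 * (1 + i%:R / m%:R) ^+ 2 * rho n (i%:R / m%:R).
apply: (@le_trans _ _ (\sum_(c : cell m) (1536 / m%:R * F c.1.1)%:E)%E).
  apply: lee_sum => c _.
  rewrite ge0_integralZl//; last by rewrite lee_fin mulr_ge0// ltW.
  rewrite integral_indic// setIT.
  apply: (@le_trans _ _ ((2 * cwidth R c)%:E * (192 * cwidth R c * rho n (crad R c))%:E)%E).
    rewrite lee_wpmul2l//; first by rewrite lee_fin mulr_ge0// ltW.
    by have := prob_hit (ccenter R c) (e0 c); rewrite normc_ccenter.
  rewrite -EFinM lee_fin /F -/(crad R c) /cwidth le_eqVlt; apply/orP; left; apply/eqP.
  by field; rewrite gt_eqF.
rewrite sumEFin lee_fin.
have -> : \sum_(c : cell m) 1536 / m%:R * F c.1.1 =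
    \sum_(i < m * m) (1536 / m%:R * (2 * (4 * m).+1%:R)) * F i.
  rewrite -(pair_big xpredT xpredT (fun (ij : 'I_(m * m) * 'I_(4 * m).+1) (b : bool) =>
    1536 / m%:R * F ij.1))/=.
  rewrite -(pair_big xpredT xpredT (fun (i : 'I_(m * m)) (j : 'I_(4 * m).+1) =>
    \sum_(b : bool) 1536 / m%:R * F i))/=.
  apply: eq_bigr => i _; rewrite !sumr_const card_bool card_ord.
  move: (1536 / m%:R) (F i) => x f.
  rewrite -(mulr_natl (_ *+ 2)) -(mulr_natl (x * f) 2).
  by move: ((4 * m).+1%:R : R) => y; ring.
rewrite -mulr_sumr.
have S76 : \sum_(i < m * m) F i <= 76 by apply: rho_sum_le => //; rewrite leq_pmulr.
have S0 : 0 <= \sum_(i < m * m) F i.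
  apply: sumr_ge0 => i _; apply: mulr_ge0 (rho_ge0 _ _).
  by apply: mulr_ge0; [rewrite invr_ge0|exact: sqr_ge0].
have hm : 1 <= m%:R :> R by rewrite ler1n.
move: (1536 : R) (ler0n R 1536) => k k0.
apply: ler_pM => //; first by rewrite mulr_ge0// divr_ge0.
rewrite -mulrA ler_wpM2l// mulrC ler_pdivrMr// -(natr1 (4 * m)) natrM.
by move: (m%:R : R) hm => x hm; lra.
Qed.

Lemma coef_random_poly (k : 'I_n.+1) t : (random_poly a t)`_k = a k t.
Proof.
rewrite /random_poly coef_sum (bigD1 k)//= coefZ coefXn eqxx mulr1.
rewrite big1 ?addr0// => j; rewrite -val_eqE/= => /negbTE jk.
by rewrite coefZ coefXn eq_sym jk mulr0.
Qed.

(** Constant polynomials have to be separated later, their lemniscates being possibly unbounded. *)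
Lemma measurable_size_le1 : measurable [set t | (size (random_poly a t) <= 1)%N].
Proof.
have -> : [set t | (size (random_poly a t) <= 1)%N] =
    \bigcap_(k in [set k : 'I_n.+1 | k != ord0]) (A k @^-1` [set (0, 0)]).
  apply/seteqP; split => [t /leq_sizeP h k /= k0|t h].
    have k1 : (0 < k)%N by rewrite lt0n; move: k0; rewrite -val_eqE.
    by rewrite /A /= -coef_random_poly h.
  apply/leq_sizeP => j j0; have [jn|jn] := ltnP j n.+1; last first.
    apply: nth_default; apply: leq_trans jn; apply: (leq_trans (size_sum _ _ _)).
    apply/bigmax_leqP => k _; apply: leq_trans (size_scale_leq _ _) _.
    by rewrite size_polyXn; exact: ltn_ord.
  have j1 : Ordinal jn != ord0 by rewrite -val_eqE/= -lt0n.
  have := h _ j1; rewrite /A /=.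
  rewrite -coef_random_poly/=; case: (_`_j) => x y; rewrite /coords/= => -[-> ->].
  by [].
apply: fin_bigcap_measurable => // k _.
rewrite -[X in measurable X]setTI; apply: mA => //.
by rewrite set_pair1; apply: measurableX.
Qed.

Lemma prob_size_le1 : (1 <= n)%N ->
  exists2 N : set T, measurable N & P N = 0%E /\
  forall t, ~ N t -> (1 < size (random_poly a t))%N.
Proof.
move=> n1; exists (A ord_max @^-1` [set (0, 0)]).
  rewrite -[X in measurable X]setTI; apply: mA => //.
  by rewrite set_pair1; apply: measurableX.
split.
  rewrite lawA; last by rewrite set_pair1; apply: measurableX.
  apply: null_set_integral.
  - by rewrite set_pair1; apply: measurableX.
  - by apply/measurable_EFinP; apply: measurable_funTS; exact: measurable_gpdf.
  - rewrite set_pair1.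
    transitivity (@lebesgue_measure R [set 0%R] * @lebesgue_measure R [set 0%R])%E.
      by apply: product_measure1E.
    by rewrite lebesgue_measure_set1 mul0e.
move=> t ht; rewrite ltnNge; apply/negP => /leq_sizeP/(_ n n1) pn; apply: ht.
by rewrite /= /A /= -coef_random_poly pn.
Qed.

(** Markov's inequality is applied to the liminf of the grid sums, which is measurable and at least
    [L] on the event outside a null set. There [L - e] is first compared with the premeasure at a
    single scale [delta], since the grid thresholds depend on [delta]. *)
Lemma hausdorff1_tail (L : R) : (8 <= n)%N -> 0 < L ->
  measurable [set t | (L%:E <= hausdorff1 (lemniscate (random_poly a t)))%E] ->
  (P [set t | (L%:E <= hausdorff1 (lemniscate (random_poly a t)))%E] <=
   (1536 * 10 * 76 / L)%:E)%E.
Proof.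
move=> n8 L0; set E := [set t | _] => mE.
have [N mN [PN hN]] := prob_size_le1 (leq_trans (isT : 1 <= 8)%N n8).
(* The shift puts every mesh in the range [n < m] of [expectation_gridsum]. *)
pose X m t : \bar R := (gridsum (m + n.+1) (random_poly a t))%:E.
have X0 m t : (0 <= X m t)%E.
  rewrite lee_fin; apply: sumr_ge0 => c _; apply: mulr_ge0 => //; apply: mulr_ge0 => //.
  by rewrite divr_ge0// mulr_ge0// addr_ge0// crad_ge0.
have mX m : measurable_fun [set: T] (X m).
  apply/measurable_EFinP; apply: measurable_sum => c; apply: measurable_funM => //.
  have -> : (fun t => (hit (random_poly a t) (ccenter R c) (cwidth R c))%:R) =
      \1_[set t | hit (random_poly a t) (ccenter R c) (cwidth R c)] :> (T -> R).
    by apply/funext => t; rewrite indic_setb.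
  by apply: measurable_indic; exact: measurable_hit.
have mEN : measurable (E `\` N) by exact: measurableD.
have le_einf (u : nat -> \bar R) (x : \bar R) N0 : (forall m, (N0 <= m)%N -> (x <= u m)%E) ->
    (x <= limn_einf u)%E.
  move=> h; rewrite limn_einf_lim.
  have -> : limn (einfs u) = ereal_sup (range (einfs u)).
    by apply/cvg_lim => //; exact: cvg_einfs_sup.
  apply: (@le_trans _ _ (einfs u N0)); last by apply: ereal_sup_ubound; exists N0.
  by apply: le_ereal_inf_tmp => _ /= [m Nm <-]; exact: h.
have liminfX t : (E `\` N) t -> (L%:E <= limn_einf (X^~ t))%E.
  move=> [Et /hN pt]; apply/lee_subgt0Pr => e e0.
  have : ((L - e)%:E < hausdorff1 (lemniscate (random_poly a t)))%E.
    by apply: lt_le_trans Et; rewrite lte_fin; lra.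
  rewrite /hausdorff1 => /ereal_sup_gt[_ /= [delta delta0 <-] h].
  have [m0 hm] := hausdorff1_pre_le_gridsum pt delta0.
  rewrite -EFinB; apply: (le_einf _ _ m0) => m m0m; apply: ltW; apply: lt_le_trans h _.
  by apply: hm; rewrite (leq_trans m0m)// leq_addr.
have iX m : (\int[P]_t X m t <= (1536 * 10 * 76)%:E)%E.
  by apply: expectation_gridsum => //; rewrite addnS ltnS leq_addl.
have fat := fatou P measurableT mX (fun m t _ => X0 m t).
have up : (limn_einf (fun m => \int[P]_t X m t) <= (1536 * 10 * 76)%:E)%E.
  apply: le_trans (limn_einf_sup _) _; rewrite limn_esup_lim.
  apply: lime_le; first exact: is_cvg_esups.
  by apply: nearW => k; apply: ge_ereal_sup => _ /= [m _ <-]; exact: iX.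
have PEN : P E = P (E `\` N).
  rewrite measureD//=; last by rewrite (le_lt_trans (probability_le1 _ _)) ?ltry.
  suff -> : P (E `&` N) = 0%E by rewrite sube0.
  apply/eqP; rewrite eq_le measure_ge0 andbT -PN le_measure ?inE//.
  exact: measurableI.
rewrite PEN EFinM lee_pdivlMr//.
apply: le_trans up; apply: le_trans fat.
rewrite muleC -(setIT (E `\` N)) -integral_indic// -ge0_integralZl//; last 2 first.
- by apply/measurable_EFinP; exact: measurable_indic.
- by rewrite lee_fin ltW.
have einf0 t : (0 <= limn_einf (X^~ t))%E by apply: (le_einf _ _ 0) => m _; exact: X0.
apply: ge0_le_integral => //.
- by move=> t _; rewrite mule_ge0// lee_fin// ltW.
- by apply: emeasurable_funM => //; apply/measurable_EFinP; exact: measurable_indic.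
- apply: measurableT_comp => //; apply: (@measurable_fun_limn_esup _ _ _ _ (fun m t => - X m t)%E) => m.
  exact: measurableT_comp.
- move=> t _; rewrite indicE; have [/[!inE] h|_] := boolP (t \in _); last by rewrite mule0.
  by rewrite mule1; exact: liminfX.
Qed.
End random_polynomial.

(** * Measurability *)

Section compactness.
Variable R : realType.
Local Notation C := R[i].
Local Notation normc := (@Normc.normc R).
Implicit Types (p : {poly C}) (z w : C) (u v : R * R).

Definition cpx u : C := Complex u.1 u.2.

Lemma continuous_horner_ReIm p :
  continuous (fun u => complex.Re p.[cpx u]) /\ continuous (fun u => complex.Im p.[cpx u]).
Proof.
elim/poly_ind: p => [|q c [hR hI]].
  by split=> u; under eq_fun do rewrite horner0/=; exact: cvg_cst.
have cfst : continuous (fun u : R * R => u.1) by move=> u; exact: cvg_fst.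
have csnd : continuous (fun u : R * R => u.2) by move=> u; exact: cvg_snd.
split.
  have -> : (fun u => complex.Re (q * 'X + c%:P).[cpx u]) =
      (fun u => complex.Re q.[cpx u] * u.1 - complex.Im q.[cpx u] * u.2 + complex.Re c).
    by apply/funext => u; rewrite hornerMXaddC /cpx; case: (q.[_]) => x y; case: c.
  move=> u; apply: cvgD; last exact: cvg_cst.
  by apply: cvgB; apply: cvgM; [exact: hR|exact: cfst|exact: hI|exact: csnd].
have -> : (fun u => complex.Im (q * 'X + c%:P).[cpx u]) =
    (fun u => complex.Re q.[cpx u] * u.2 + complex.Im q.[cpx u] * u.1 + complex.Im c).
  by apply/funext => u; rewrite hornerMXaddC /cpx; case: (q.[_]) => x y; case: c.
move=> u; apply: cvgD; last exact: cvg_cst.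
by apply: cvgD; apply: cvgM; [exact: hR|exact: csnd|exact: hI|exact: cfst].
Qed.

Definition defect p u : R := `|normc p.[cpx u] - 1|.

Lemma continuous_defect p : continuous (defect p).
Proof.
have [hR hI] := continuous_horner_ReIm p.
pose N u := complex.Re p.[cpx u] * complex.Re p.[cpx u] +
  complex.Im p.[cpx u] * complex.Im p.[cpx u].
have cN : continuous N.
  by move=> u; apply: cvgD; apply: cvgM; (exact: hR || exact: hI).
have cS : continuous (fun u => Num.sqrt (N u)).
  by move=> u; apply: (continuous_comp (cN u)); exact: sqrt_continuous.
have -> : defect p = (fun u => `|Num.sqrt (N u) - 1|).
  by apply/funext => u; rewrite /defect /N; case: (p.[_]).
by move=> u; apply: cvg_norm; apply: cvgB; [exact: cS|exact: cvg_cst].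
Qed.

Lemma lemniscate_defect p u : lemniscate p (cpx u) <-> defect p u = 0.
Proof.
rewrite lemniscateE /defect; split => [->|/eqP]; first by rewrite subrr normr0.
by rewrite normr_eq0 subr_eq0 => /eqP.
Qed.

Definition cbox v (r : R) : set (R * R) := [set u | `|u.1 - v.1| <= r /\ `|u.2 - v.2| <= r].
Definition obox v (r : R) : set (R * R) := [set u | `|u.1 - v.1| < r /\ `|u.2 - v.2| < r].

Lemma compact_cbox v r : compact (cbox v r).
Proof.
have -> : cbox v r = `[v.1 - r, v.1 + r]%classic `*` `[v.2 - r, v.2 + r]%classic.
  by apply/seteqP; split => u; rewrite /cbox /= !in_itv/= !ler_distl.
by apply: compact_setX; exact: segment_compact.
Qed.

Lemma open_obox v r : open (obox v r).
Proof.
have -> : obox v r = (fst @^-1` `](v.1 - r), (v.1 + r)[%classic) `&`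
    (snd @^-1` `](v.2 - r), (v.2 + r)[%classic).
  by apply/seteqP; split => u; rewrite /obox /= !in_itv/= !ltr_distl.
by apply: openI; apply: open_comp; rewrite ?interval_open// => u _;
  [exact: cvg_fst|exact: cvg_snd].
Qed.

(** The image of a compact box is closed, so the value 0 is attained. *)
Lemma defect_small_cbox p v r : (forall e, 0 < e -> exists2 u, cbox v r u & defect p u < e) ->
  exists2 u, cbox v r u & defect p u = 0.
Proof.
move=> h; have cK : compact (defect p @` cbox v r).
  apply: continuous_compact; last exact: compact_cbox.
  by apply: continuous_subspaceT => u; exact: continuous_defect.
have [u Ku du] : (defect p @` cbox v r) 0.
  apply: (compact_closed (@Rhausdorff R) cK) => B /nbhs_ballP[e /= e0 eB].
  have [u Ku du] := h e e0; exists (defect p u); split; first by exists u.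
  by apply: eB; rewrite /ball/= sub0r normrN ger0_norm// /defect.
by exists u.
Qed.

Lemma compact_lemniscate p : (1 < size p)%N -> compact [set u | lemniscate p (cpx u)].
Proof.
move=> /lemniscate_bounded[M hM].
apply: (subclosed_compact _ (@compact_cbox (0, 0) M)).
  have -> : [set u | lemniscate p (cpx u)] = defect p @^-1` [set 0].
    by apply/seteqP; split => u /lemniscate_defect.
  by apply: closed_comp => [u _|]; [exact: continuous_defect|exact: closed_eq].
move=> u /hM; rewrite /cpx /cbox/= !subr0 => uM.
have h (x y : R) : `|x| <= Num.sqrt (x ^+ 2 + y ^+ 2).
  by rewrite -sqrtr_sqr ler_sqrt ?lerDl ?addr_ge0 ?sqr_ge0.
by split; apply: le_trans uM; [exact: h|rewrite addrC; exact: h].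
Qed.

Definition qpt (q : rat * rat) : R * R := (ratr q.1, ratr q.2).

Lemma qpt_dense u e : 0 < e -> exists q, obox u e (qpt q).
Proof.
move=> e0.
have [q1 hq1] := @rat_in_itvoo R u.1 (u.1 + e) ltac:(by rewrite ltrDl).
have [q2 hq2] := @rat_in_itvoo R u.2 (u.2 + e) ltac:(by rewrite ltrDl).
exists (q1, q2); move: hq1 hq2; rewrite !in_itv/= => /andP[a b] /andP[a' b'].
by split; rewrite /= gtr0_norm; lra.
Qed.

Lemma defect_near p u r : 0 < r -> defect p u = 0 ->
  forall e, 0 < e -> exists2 q, obox u r (qpt q) & defect p (qpt q) < e.
Proof.
move=> r0 du e e0; have := @continuous_defect p u.
rewrite /continuous_at du => /cvgrPdist_lt/(_ e e0); rewrite near_simpl.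
move=> /nbhs_ballP[s /= s0 sB].
have [q [q1 q2]] := @qpt_dense u (Num.min r s) ltac:(by rewrite lt_min r0).
move: q1 q2; rewrite !lt_min => /andP[q1 q1'] /andP[q2 q2'].
exists q => //; have : `|0 - defect p (qpt q)| < e.
  by apply: sB; split; rewrite /ball/= distrC.
by rewrite sub0r normrN ger0_norm// /defect.
Qed.

(** Boxes form a countable type, and so do the finite lists of finite lists of them; unions over
    candidate covers are then countable. *)
Definition box : Type := (rat * rat * nat)%type.
Definition boxset (b : box) : set (R * R) := cbox (qpt b.1) b.2.+1%:R^-1.
Definition famset (F : seq box) : set C := [set z | exists2 b, b \in F & boxset b (coords z)].

Lemma coordsK : cancel (@coords R) cpx. Proof. by case. Qed.
Lemma cpxK : cancel cpx (@coords R). Proof. by case. Qed.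

Lemma box_near u e : 0 < e -> exists b : box,
  obox (qpt b.1) b.2.+1%:R^-1 u /\ boxset b `<=` obox u e.
Proof.
move=> e0; have e20 : 0 < e / 2 by rewrite divr_gt0.
have [k] : exists k, k.+1%:R^-1 < e / 2.
  by have := @ltr_add_invr R 0 (e / 2) e20 => -[k]; rewrite add0r => h; exists k.
set r := k.+1%:R^-1 => kr.
have r0 : 0 < r by rewrite invr_gt0.
have [q [q1 q2]] := qpt_dense u r0.
exists (q, k); rewrite /= -/r; split; first by split; rewrite distrC.
move=> v [/= v1 v2].
split; rewrite -/r in v1 v2 *.
  have -> : v.1 - u.1 = (v.1 - (qpt q).1) + ((qpt q).1 - u.1) by rewrite addrA subrK.
  by apply: le_lt_trans (ler_normD _ _) _; move: v1 q1 => /=; lra.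
have -> : v.2 - u.2 = (v.2 - (qpt q).2) + ((qpt q).2 - u.2) by rewrite addrA subrK.
by apply: le_lt_trans (ler_normD _ _) _; move: v2 q2 => /=; lra.
Qed.

Lemma obox_normc u v e : obox u e v -> normc (cpx v - cpx u) < e + e.
Proof.
move=> [h1 h2]; apply: le_lt_trans (ltrD h1 h2).
exact: normc_le_ReIm.
Qed.

Lemma hausdorff1_pre_le_fam (delta : R) (A : set C) (F : seq (seq box)) : 0 <= delta ->
  (forall g, g \in F -> (cdiam (famset g) <= delta%:E)%E) ->
  (forall z, A z -> exists2 g, g \in F & famset g z) ->
  (hausdorff1_pre delta A <= \sum_(g <- F) cdiam (famset g))%E.
Proof.
move=> d0 hd hA; rewrite -(big_map famset xpredT (fun V => cdiam V)).
apply: hausdorff1_pre_le_seq => //.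
  move=> i; have [h|h] := ltnP i (size F); last first.
    by rewrite nth_default ?size_map// cdiam_set0 lee_fin.
  by rewrite (nth_map [::])// hd// mem_nth.
move=> z /hA[g gF gz]; exists (index g F) => //.
by rewrite (nth_map [::]) ?nth_index ?index_mem.
Qed.

(* Each set of the cover is fattened to an open set at a summable cost, and a
   finite subcover by rational boxes is extracted. *)
Lemma fam_of_hausdorff1_pre (delta c : R) (A : set C) : 0 < delta ->
  compact [set u | A (cpx u)] -> (hausdorff1_pre delta A < c%:E)%E ->
  exists F : seq (seq box), [/\
    forall g, g \in F -> (cdiam (famset g) <= (2 * delta)%:E)%E,
    (\sum_(g <- F) cdiam (famset g) < c%:E)%E &
    forall z, A z -> exists2 g, g \in F & famset g z].
Proof.
move=> d0 cA /ereal_inf_lt[_ [U /= [hU AU] <-] Sc].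
have U0 i : (0 <= cdiam (U i))%E by exact: cdiam_ge0.
have Ufin i : cdiam (U i) \is a fin_num.
  by rewrite ge0_fin_numE// (le_lt_trans (hU i))// ltry.
pose x i : R := fine (cdiam (U i)).
have xE i : (x i)%:E = cdiam (U i) by rewrite fineK.
have x0 i : 0 <= x i by rewrite fine_ge0.
have xd i : x i <= delta by rewrite -lee_fin xE.
have [s s0 hs] : exists2 s : R, 0 < s & forall N, \sum_(i < N) x i + s <= c.
  have S0 : (0 <= \sum_(0 <= i <oo) cdiam (U i))%E by apply: nneseries_ge0 => i _ _.
  have Sfin : (\sum_(0 <= i <oo) cdiam (U i))%E \is a fin_num.
    by rewrite ge0_fin_numE// (lt_trans Sc)// ltry.
  exists (c - fine (\sum_(0 <= i <oo) cdiam (U i))%E).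
    by rewrite subr_gt0 -lte_fin fineK.
  move=> N; rewrite addrCA gerDl subr_le0 -lee_fin fineK//.
  rewrite (nneseries_split 0 N); last by move=> k _; exact: U0.
  rewrite add0n big_mkord -sumEFin; under eq_bigr do rewrite xE.
  by rewrite leeDl// nneseries_ge0.
(* Fattening by [e i] moves each end of a segment by less than [2 * e i], so a diameter grows by at
   most [4 * e i]. The choice keeps each increase below [delta] and their sum within half of the
   slack [s]. *)
pose e i : R := Num.min delta (s / 2) / 8 / 2 ^+ i.
have m0 : 0 < Num.min delta (s / 2) by rewrite lt_min d0 divr_gt0.
have e0 i : 0 < e i by rewrite !divr_gt0// exprn_gt0.
have esum N : \sum_(i < N) 4 * e i <= s / 2.
  suff : \sum_(i < N) 4 * e i <= Num.min delta (s / 2) * (1 - (2 ^+ N)^-1).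
    move=> h; apply: le_trans h _; apply: (@le_trans _ _ (Num.min delta (s / 2))).
      by rewrite ler_piMr ?(ltW m0)// gerBl invr_ge0 exprn_ge0.
    by rewrite ge_min lexx orbT.
  elim: N => [|N ih]; first by rewrite big_ord0 expr0 invr1 subrr mulr0.
  rewrite big_ord_recr/=; apply: le_trans (lerD ih (lexx _)) _.
  rewrite le_eqVlt; apply/orP; left; apply/eqP; rewrite /e exprS.
  have : 2 ^+ N != 0 :> R by rewrite gt_eqF// exprn_gt0.
  by move: (2 ^+ N) => y y0; field.
have ed i : 4 * e i <= delta.
  have : 4 * e i <= 4 * (Num.min delta (s / 2) / 8).
    rewrite ler_wpM2l// ler_piMr ?divr_ge0 ?(ltW m0)// invf_le1 ?exprn_gt0//.
    by rewrite exprn_ege1// ler1n.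
  have : Num.min delta (s / 2) <= delta by rewrite ge_min lexx.
  by lra.
pose V i : set (R * R) := [set v | exists2 u, U i (cpx u) & obox u (e i) v].
have VU i z w : V i (coords z) -> V i (coords w) -> normc (z - w) <= x i + 4 * e i.
  move=> [u1 U1 /obox_normc h1] [u2 U2 /obox_normc h2].
  rewrite !coordsK in h1 h2.
  have -> : z - w = (z - cpx u1) + ((cpx u1 - cpx u2) - (w - cpx u2)) by ring.
  apply: le_trans (le_normcD _ _) _.
  have := le_normcB (cpx u1 - cpx u2) (w - cpx u2).
  have : normc (cpx u1 - cpx u2) <= x i by rewrite -lee_fin xE; exact: cdiam_ub.
  by lra.
pose D : set (nat * box) := [set ib | boxset ib.2 `<=` V ib.1].
pose f (ib : nat * box) : set (R * R) := obox (qpt ib.2.1) ib.2.2.+1%:R^-1.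
pose L N : seq (nat * box) :=
  [seq ib <- pmap unpickle (iota 0 N) | `[< D ib >] ].
have memL N ib : D ib -> (pickle ib < N)%N -> ib \in L N.
  move=> Dib ibN; rewrite mem_filter (asboolT Dib)/= mem_pmap.
  by apply/mapP; exists (pickle ib); rewrite ?mem_iota ?pickleK.
(* Pairs of an index and a box are ordered by their codes, and compactness bounds the codes needed:
   this is the finite subcover. *)
have [N hN] : exists N, forall u, A (cpx u) -> exists2 ib, ib \in L N & f ib u.
  have := (compact_near_coveringP _).1 cA nat \oo (fun N u => exists2 ib, ib \in L N & f ib u) _.
  case=> [u Au|N0 _ hN0]; last by exists N0 => u Au; exact: (hN0 N0 (leqnn _)).
  have [i _ Ui] := AU _ Au.
  have [b [b1 b2]] := box_near u (e0 i).
  exists (f (i, b), [set N | (pickle (i, b) < N)%N]).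
    split; first by apply: open_nbhs_nbhs; split => //; exact: open_obox.
    by exists (pickle (i, b)).+1.
  move=> [v N0] [/= fv Nb]; exists (i, b) => //; apply: memL => //.
  by move=> w /b2 uw; exists u.
pose M := (\max_(ib <- L N) ib.1).+1.
(* Boxes are grouped by the cover set whose fattening contains them, so each diameter is paid
   once. *)
pose g i : seq box := [seq ib.2 | ib <- L N & ib.1 == i].
have gV i z : famset (g i) z -> V i (coords z).
  move=> [b /mapP[ib]]; rewrite mem_filter => /andP[/eqP <- ibD] -> bz.
  by move: ibD; rewrite mem_filter => /andP[/asboolP/(_ _ bz)].
have gd i : (cdiam (famset (g i)) <= (x i + 4 * e i)%:E)%E.
  apply: cdiam_le; first by rewrite addr_ge0// mulr_ge0// ltW.
  by move=> z w /gV Vz /gV Vw; exact: VU.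
exists [seq g i | i <- iota 0 M]; split.
- move=> _ /mapP[i _ ->]; apply: le_trans (gd i) _; rewrite lee_fin.
  by have := xd i; have := ed i; lra.
- rewrite big_map; apply: (@le_lt_trans _ _ (\sum_(i < M) (x i + 4 * e i)%:E)%E).
    rewrite -(big_mkord xpredT (fun i => (x i + 4 * e i)%:E)) /index_iota subn0.
    by apply: lee_sum => i _; exact: gd.
  rewrite sumEFin lte_fin big_split/=.
  by have := hs M; have := esum M; lra.
- move=> z Az; have [|ib ibD ibz] := hN (coords z); first by rewrite coordsK.
  exists (g ib.1).
    apply: map_f; rewrite mem_iota add0n ltnS.
    exact: (@leq_bigmax_seq _ _ xpredT (fun ib : nat * box => ib.1)).
  exists ib.2; first by apply: map_f; rewrite mem_filter eqxx.
  by move: ibz => [z1 z2]; split; exact: ltW.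
Qed.

End compactness.

(** * The length event from countably many conditions *)

Section measurability.
Context (R : realType) (d : measure_display) (T : measurableType d).
Variable p : T -> {poly R[i]}.
Hypothesis mp : forall z, measurable_fun [set: T] (fun t => coords (p t).[z]).
Local Notation C := R[i].
Implicit Types (F : seq (seq box)).

Lemma measurable_defect u : measurable_fun [set: T] (fun t => defect (p t) u).
Proof.
rewrite /defect; apply: measurableT_comp => //; apply: measurable_funB => //.
under eq_fun do rewrite -sqrt_nrm2_coords.
exact: (measurableT_comp (@measurable_sqrt_nrm2 R) (mp _)).
Qed.

(** The inclusion fails exactly when some rational box disjoint from the closed set [E] meets the
    lemniscate. Rational points of the open box suffice, and compactness of the closed box recovers
    a zero of [defect] from small values. *)
Lemma measurable_lemniscate_subset (E : set C) :
  (forall u, ~ E (cpx u) -> exists2 e, 0 < e & forall v, obox u e v -> ~ E (cpx v)) ->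
  measurable [set t | lemniscate (p t) `<=` E].
Proof.
move=> oE.
pose D (b : box) := forall v : R * R, boxset b v -> ~ E (cpx v).
pose Q (b : box) q := obox (qpt R b.1) b.2.+1%:R^-1 (qpt R q).
pose H (b : box) : set T :=
  [set t | D b /\ forall m : nat, exists2 q, Q b q & defect (p t) (qpt R q) < m.+1%:R^-1].
have mH b : measurable (H b).
  have [Db|nDb] := pselect (D b); last first.
    by rewrite (_ : H b = set0)//; apply/seteqP; split => // t [].
  have -> : H b = \bigcap_m \bigcup_q
      [set t | `[< Q b q >] && (defect (p t) (qpt R q) < m.+1%:R^-1)].
    apply/seteqP; split => t.
      move=> [_ h] m _; have [q Qq hq] := h m; exists q => //=.
      by rewrite hq andbT; exact: asboolT.
    move=> h; split => // m; have [q _ /=/andP[/asboolP Qq hq]] := h m I; by exists q.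
  apply: bigcapT_measurable => m; apply: countable_bigcupT_measurable => // q.
  apply: measurable_setb; apply: measurable_and => //.
  by apply: measurable_fun_ltr => //; exact: measurable_defect.
have -> : [set t | lemniscate (p t) `<=` E] = ~` \bigcup_b H b.
  apply/seteqP; split => t.
    move=> hE [b _ [Db h]].
    have [e e0|u bu] := @defect_small_cbox R (p t) (qpt R b.1) b.2.+1%:R^-1.
      have [k] := @ltr_add_invr R 0 e e0; rewrite add0r => ke.
      have [q [q1 q2] hq] := h k; exists (qpt R q); last exact: lt_trans ke.
      by split; exact: ltW.
    by move=> /lemniscate_defect/hE; exact: Db bu.
  move=> nH z Lz; apply: contrapT => nEz; apply: nH.
  rewrite -(coordsK z) in nEz Lz; set u := coords z in nEz Lz.
  have [e e0 he] := oE u nEz.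
  have [b [b1 b2]] := box_near u e0.
  exists b => //; split; first by move=> v /b2; exact: he.
  move=> m; have du : defect (p t) u = 0 by apply/lemniscate_defect.
  move: b1; rewrite /obox/=; set r := b.2.+1%:R^-1 => -[h1 h2].
  pose s := Num.min (r - `|u.1 - (qpt R b.1).1|) (r - `|u.2 - (qpt R b.1).2|).
  have s0 : 0 < s by rewrite lt_min !subr_gt0 h1.
  have [q [q1 q2] hq] := defect_near s0 du (ltac:(by rewrite invr_gt0) : 0 < m.+1%:R^-1).
  exists q => //; move: q1 q2; rewrite /s !lt_min => /andP[q1 _] /andP[_ q2].
  split; rewrite -/r.
    rewrite -(subrK u.1 (qpt R q).1) -addrA; apply: le_lt_trans (ler_normD _ _) _.
    by move: q1; lra.
  rewrite -(subrK u.2 (qpt R q).2) -addrA; apply: le_lt_trans (ler_normD _ _) _.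
  by move: q2; lra.
by apply: measurableC; apply: (@countable_bigcupT_measurable _ _ (rat * rat * nat)%type).
Qed.

Lemma famset_open (g : seq box) (u : R * R) : ~ famset g (cpx u) ->
  exists2 e, 0 < e & forall v, obox u e v -> ~ famset g (cpx v).
Proof.
elim: g => [_|b g ih nu]; first by exists 1 => // v _ [].
have [e1 e10 h1] : exists2 e, 0 < e & forall v, obox u e v -> ~ famset g (cpx v).
  by apply: ih => -[c cg cu]; apply: nu; exists c => //; rewrite inE cg orbT.
have [e2 e20 h2] : exists2 e, 0 < e & forall v, obox u e v -> ~ boxset b v.
  have : ~ boxset b u by move=> bu; apply: nu; exists b; rewrite ?inE ?eqxx ?cpxK.
  rewrite /boxset /cbox/=; set r := _^-1 => /not_andP[/negP|/negP]; rewrite -ltNge => h.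
    exists (`|u.1 - (qpt R b.1).1| - r); first by rewrite subr_gt0.
    move=> v [v1 _] [w1 _].
    have : `|u.1 - (qpt R b.1).1| <= `|v.1 - u.1| + `|v.1 - (qpt R b.1).1|.
      rewrite [`|v.1 - u.1|]distrC; apply: le_trans (ler_normD _ _).
      by rewrite addrA subrK.
    by move: v1 w1; lra.
  exists (`|u.2 - (qpt R b.1).2| - r); first by rewrite subr_gt0.
  move=> v [_ v1] [_ w1].
  have : `|u.2 - (qpt R b.1).2| <= `|v.2 - u.2| + `|v.2 - (qpt R b.1).2|.
    rewrite [`|v.2 - u.2|]distrC; apply: le_trans (ler_normD _ _).
    by rewrite addrA subrK.
  by move: v1 w1; lra.
exists (Num.min e1 e2); first by rewrite lt_min e10.
move=> v; rewrite /obox/= !lt_min => -[/andP[a1 a2] /andP[a3 a4]] [c].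
rewrite inE => /orP[/eqP ->|cg]; first by rewrite cpxK; exact: h2.
by move=> cv; apply: (h1 v) => //; exists c.
Qed.

(** The cost of a family is deterministic; in [covered] the sample point enters only through an
    inclusion. *)
Definition fam_covers (delta c : R) F : Prop :=
  (forall g, g \in F -> (cdiam (famset g : set C) <= delta%:E)%E) /\
  (\sum_(g <- F) cdiam (famset g : set C) < c%:E)%E.

Definition covered (delta c : R) : set T :=
  \bigcup_F [set t | fam_covers delta c F /\
    lemniscate (p t) `<=` famset (flatten F)].

Lemma famset_flatten F (z : C) : famset (flatten F) z <-> exists2 g, g \in F & famset g z.
Proof.
split=> [[b /flattenP[g gF bg] bz]|[g gF [b bg bz]]].
  by exists g => //; exists b.
by exists b => //; apply/flattenP; exists g.
Qed.

Lemma measurable_covered delta c : measurable (covered delta c).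
Proof.
apply: (@countable_bigcupT_measurable _ _ (seq (seq (rat * rat * nat)))) => // F.
have [h|h] := pselect (fam_covers delta c F); last first.
  by rewrite (_ : [set _ | _] = set0)//; apply/seteqP; split => // t [].
rewrite (_ : [set _ | _] = [set t | lemniscate (p t) `<=` famset (flatten F)]).
  by apply: measurable_lemniscate_subset => u; exact: famset_open.
by apply/seteqP; split => t; [case|].
Qed.

Lemma covered_hausdorff1_pre delta c t : 0 <= delta -> covered delta c t ->
  (hausdorff1_pre delta (lemniscate (p t)) < c%:E)%E.
Proof.
move=> d0 [F _ [[h1 h2] h3]]; apply: le_lt_trans h2.
by apply: hausdorff1_pre_le_fam => // z /h3/famset_flatten.
Qed.

Lemma hausdorff1_pre_covered delta c t : 0 < delta -> (1 < size (p t))%N ->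
  (hausdorff1_pre delta (lemniscate (p t)) < c%:E)%E -> covered (2 * delta) c t.
Proof.
move=> d0 /compact_lemniscate cp h.
have [F [h1 h2 h3]] := fam_of_hausdorff1_pre d0 cp h.
by exists F => //; split => // z /h3/famset_flatten.
Qed.

Lemma hausdorff1_pre_decr (A : set C) delta delta' : delta <= delta' ->
  (hausdorff1_pre delta' A <= hausdorff1_pre delta A)%E.
Proof.
move=> dd; apply: le_ereal_inf_tmp => _ [U [hU AU] <-]; apply: ereal_inf_lbound.
by exists U => //; split => // i; apply: le_trans (hU i) _; rewrite lee_fin.
Qed.

(** A supremum of numbers below [L] may equal [L], so a margin [1 / (k + 1)] common to all scales is
    required. The scale is halved beforehand because fattening doubles it. *)
Lemma hausdorff1_lt_covered (L : R) t : (1 < size (p t))%N ->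
  (hausdorff1 (lemniscate (p t)) < L%:E)%E <->
  (\bigcup_k \bigcap_j covered j.+1%:R^-1 (L - k.+1%:R^-1)) t.
Proof.
move=> pt; split.
  move=> hL; have [k hk] : exists k : nat,
      (hausdorff1 (lemniscate (p t)) < (L - k.+1%:R^-1)%:E)%E.
    case: (hausdorff1 _) hL => [h||]//; last by exists 0%N; exact: ltNyr.
    by rewrite lte_fin => /ltr_add_invr[k hk]; exists k; rewrite lte_fin ltrBrDr.
  exists k => // j _; have -> : j.+1%:R^-1 = 2 * (j.+1%:R^-1 / 2) :> R by field.
  have j0 : 0 < j.+1%:R^-1 / 2 :> R by rewrite divr_gt0// invr_gt0.
  apply: (hausdorff1_pre_covered j0 pt).
  apply: le_lt_trans hk; apply: ereal_sup_ubound.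
  by exists (j.+1%:R^-1 / 2).
move=> [k _ hk]; apply: (@le_lt_trans _ _ (L - k.+1%:R^-1)%:E); last first.
  by rewrite lte_fin gtrBl invr_gt0.
apply: ge_ereal_sup => _ [delta /= d0 <-].
have [j] := @ltr_add_invr R 0 delta d0; rewrite add0r => jd.
apply: le_trans (hausdorff1_pre_decr _ (ltW jd)) _.
by apply: ltW; apply: covered_hausdorff1_pre; [rewrite invr_ge0|exact: hk].
Qed.

(** For nonconstant polynomials the event is the complement of [W]. For constant ones the lemniscate
    takes two values, decided by [defect] at the origin, and each [B A] is everything or empty. *)
Lemma measurable_hausdorff1_ge (L : R) :
  measurable [set t | (size (p t) <= 1)%N] ->
  measurable [set t | (L%:E <= hausdorff1 (lemniscate (p t)))%E].
Proof.
set S := [set t | _] => mS.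
pose Z := [set t | defect (p t) (0, 0) <= 0].
have mZ : measurable Z.
  by apply: measurable_setb; apply: measurable_fun_ler => //; exact: measurable_defect.
pose W := \bigcup_k \bigcap_j covered j.+1%:R^-1 (L - k.+1%:R^-1).
have mW : measurable W.
  apply: bigcupT_measurable => k; apply: bigcapT_measurable => j.
  exact: measurable_covered.
pose B (A : set C) : set T := [set t | (L%:E <= hausdorff1 A)%E].
have mB A : measurable (B A).
  have [h|h] := boolP (L%:E <= hausdorff1 A)%E.
    by rewrite (_ : B A = setT)//; apply/seteqP; split.
  by rewrite (_ : B A = set0)//; apply/seteqP; split => // t /=; exact/negP.
(* A polynomial of size at most 1 has lemniscate the whole plane or empty. *)
have SE t : S t -> lemniscate (p t) = if defect (p t) (0, 0) <= 0 then setT else set0.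
  rewrite /S/= => /size1_polyC pc.
  have dE u : defect (p t) u = defect (p t) (0, 0) by rewrite /defect pc !hornerC.
  case: ifPn => h; apply/seteqP; split => // z.
    move=> _; rewrite -(coordsK z); apply/lemniscate_defect; rewrite dE.
    by apply/eqP; rewrite eq_le h /defect normr_ge0.
  by rewrite -(coordsK z) => /lemniscate_defect; rewrite dE => h'; rewrite h' lexx in h.
have -> : [set t | (L%:E <= hausdorff1 (lemniscate (p t)))%E] =
    (~` S `&` ~` W) `|` (S `&` ((Z `&` B setT) `|` (~` Z `&` B set0))).
  apply/seteqP; split => t.
    move=> /= ht; have [St|nSt] := pselect (S t); last first.
      left; split => // Wt; move: ht; rewrite leNgt => /negP; apply.
      by apply/hausdorff1_lt_covered => //; rewrite ltnNge; exact/negP.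
    right; split => //; move: ht; rewrite /B/= (SE t St).
    by case: ifPn => h; [left|right]; split => //; exact/negP.
  move=> [[nSt nWt]|[St h]] /=.
    have pt : (1 < size (p t))%N by rewrite ltnNge; exact/negP.
    by rewrite leNgt; apply/negP => /(hausdorff1_lt_covered L pt).1.
  rewrite (SE t St); move: h => [[]|[]]; rewrite /Z /B/=; first by move=> ->.
  by move=> /negP/negbTE ->.
apply: measurableU; apply: measurableI => //; try exact: measurableC.
by apply: measurableU; apply: measurableI => //; exact: measurableC.
Qed.

End measurability.

Theorem corollary2 (R : realType)
  (d : nat -> measure_display) (T : forall n : nat, measurableType (d n))
  (P : forall n : nat, probability (T n) R)
  (a : forall n : nat, 'I_n.+1 -> T n -> R[i])
  (a_iid : forall n : nat, (1 <= n)%N -> iid_std_cgauss (P n) (a n))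
  (L : nat -> R) (L_infty : L n @[n --> \oo] --> +oo) :
  P n [set w | ((L n)%:E <= hausdorff1 (lemniscate (random_poly (a n) w)))%E]
    @[n --> \oo] --> 0%E.
Proof.
have L0 : \forall n \near \oo, 0 < L n by move/cvgryPgt : L_infty; exact.
pose c : R := 1536 * 10 * 76.
(* The upper bound holds once [8 <= n] and [L n] is positive, and it tends to 0 because [c] does not
   depend on [n]. *)
apply: (@squeeze_cvge _ _ _ _ (fun=> 0%E) _ (fun n => (c / L n)%:E)).
- near=> n.
  have n8 : (8 <= n)%N by near: n; exists 8%N.
  have n1 : (1 <= n)%N by apply: leq_trans n8.
  have Ln : 0 < L n by near: n.
  rewrite measure_ge0/=; apply: (hausdorff1_tail (a_iid n n1) n8 Ln).
  apply: measurable_hausdorff1_ge; last exact: (measurable_size_le1 (a_iid n n1)).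
  by move=> z; exact: (measurable_coords_horner (a_iid n n1)).
- exact: cvg_cst.
- apply: cvg_EFin; first by near=> n.
  rewrite -(mulr0 c); apply: cvgM; first exact: cvg_cst.
  by apply/(gtr0_cvgV0 L0).
Unshelve. all: by end_near.
Qed.
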